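(* Assume $d \ge 2\log n$. There exist universal constants $c_1,c_2,c_3>0$ such that, for $n$ large enough, with probability $1-o(1)$ (as $n\to\infty$), any maximum likelihood pair $(\hat\pi,\hat Q)$ satisfies \[ \mathrm{ov}(\pi^\star,\hat\pi)\;\ge\; 1-\max\left(60\sigma^2,\; c_1\frac{d}{n},\; c_2\frac{\log n}{d\log d}\right) \] and \[ \frac{\ell^2(Q^\star,\hat Q)}{2d}\;\le\; c_1\frac{d}{n}+c_2\sigma^2+c_3\max\left(\frac{d\log n}{n},\sqrt{\frac{\log n}{n}}\right). \]
   Context: Standing model: $n\ge 1$ and $d=d_n\ge 1$ are integers ($d$ may depend on $n$; asymptotics are as $n\to\infty$). $X=(x_1,\dots,x_n)\in\mathbb R^{d\times n}$ and $Z=(z_1,\dots,z_n)\in\mathbb R^{d\times n}$ have all columns i.i.d. $\mathcal N(0,I_d)$, with $X$ and $Z$ independent. $Q^\star\in\mathcal O(d)$ is a fixed orthogonal matrix, $\pi^\star\in\mathcal S_n$ a fixed permutation of $[n]$, $\sigma>0$ a noise level (possibly depending on $n$), and $y_i=Q^\star x_{\pi^\star(i)}+\sigma z_i$ for $i\in[n]$, $Y=(y_1,\dots,y_n)$. Metrics: $\mathrm{ov}(\pi,\pi')=\frac1n\#\{i\in[n]:\pi(i)=\pi'(i)\}$; $c^2(\pi,\pi')=\frac1n\sum_{i=1}^n\|x_{\pi(i)}-x_{\pi'(i)}\|^2$; $\ell^2(Q,Q')=\|Q-Q'\|_F^2$. A maximum likelihood pair is any $(\hat\pi,\hat Q)\in\operatorname{argmin}_{(\pi,Q)\in\mathcal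 S_n\times\mathcal O(d)}\frac1n\sum_{i=1}^n\|x_{\pi(i)}-Q^\top y_i\|^2$. *)

(* Defs.v *)
From HB Require Import structures.
From mathcomp Require Import all_boot all_order all_algebra all_fingroup.
From mathcomp Require Import all_classical all_reals all_analysis.
Set Implicit Arguments. Unset Strict Implicit. Unset Printing Implicit Defensive.
Import Order.TTheory GRing.Theory Num.Theory.
Local Open Scope classical_set_scope.
Local Open Scope ring_scope.

Section Defs.
Variable R : realType.

Definition orthogonal_mx (d : nat) (Q : 'M[R]_d) : Prop := Q *m Q^T = 1%:M.

Definition sqnorm (d : nat) (v : 'cV[R]_d) : R := \sum_(k < d) (v k 0) ^+ 2.

Definition obs_matrix (d n : nat) (Qs : 'M[R]_d) (pis : 'S_n) (sigma : R)
  (X Z : 'M[R]_(d, n)) : 'M[R]_(d, n) :=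
  \matrix_(k < d, i < n) ((Qs *m col (pis i) X) k 0 + sigma * Z k i).

Definition mle_loss (d n : nat) (X Y : 'M[R]_(d, n)) (pi : 'S_n) (Q : 'M[R]_d) : R :=
  n%:R^-1 * \sum_(i < n) sqnorm (col (pi i) X - Q^T *m col i Y).

Definition is_mle (d n : nat) (X Y : 'M[R]_(d, n)) (pi : 'S_n) (Q : 'M[R]_d) : Prop :=
  orthogonal_mx Q /\
  forall (pi' : 'S_n) (Q' : 'M[R]_d), orthogonal_mx Q' ->
    mle_loss X Y pi Q <= mle_loss X Y pi' Q'.

Definition ov (n : nat) (pi pi' : 'S_n) : R :=
  (#|[set i : 'I_n | pi i == pi' i]|)%:R / n%:R.

Definition ell2 (d : nat) (Q Q' : 'M[R]_d) : R :=
  \sum_(i < d) \sum_(j < d) (Q i j - Q' i j) ^+ 2.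

Definition gaussian_design {dT : measure_display} {T : measurableType dT}
  (P : probability T R) (d n : nat) (X Z : 'I_d -> 'I_n -> T -> R) : Prop :=
  let W := fun k : bool * 'I_d * 'I_n =>
             if k.1.1 then X k.1.2 k.2 else Z k.1.2 k.2 in
  (forall k, measurable_fun setT (W k)) /\
  (forall k (B : set R), measurable B -> P (W k @^-1` B) = normal_prob 0 1 B) /\
  (forall B : bool * 'I_d * 'I_n -> set R, (forall k, measurable (B k)) ->
     P (\bigcap_(k in [set: bool * 'I_d * 'I_n]) (W k @^-1` B k))
     = (\prod_(k : bool * 'I_d * 'I_n) fine (P (W k @^-1` B k)))%:E).

Definition sample_mx {T : Type} (d n : nat) (X : 'I_d -> 'I_n -> T -> R) (w : T)
  : 'M[R]_(d, n) := \matrix_(k < d, i < n) X k i w.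

End Defs.
Arguments ov R {n} pi pi'.

(* Main.v *)
Require Import Defs.
From HB Require Import structures.
From mathcomp Require Import all_boot all_order all_algebra all_fingroup.
From mathcomp Require Import all_classical all_reals all_analysis.
From mathcomp Require Import measurable_realfun.
From mathcomp Require Import zify ring lra.
Import Order.TTheory GRing.Theory Num.Theory.
Import numFieldNormedType.Exports.
Local Open Scope classical_set_scope.
Local Open Scope ring_scope.
Set Implicit Arguments.
Unset Strict Implicit.
Unset Printing Implicit Defensive.

(** Write [gap Q pi] for [n / 2] times the excess loss of [(pi, Q)] over the
    planted pair, [k] for the number of errors of [pi] and [r = n / k].  It is
    [A / 2] minus a linear form in [Z] of variance [sigma^2 A], where
    [A = sum_i |Q x_(pi i) - Qs x_(pis i)|^2].  Integrating out [Z], then the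
    columns of [X] along an order in which half of the errors see a fresh column,
    gives [E exp (- lam gap) <= (1 + lam / 2) ^ (- k d / 4)].  With [lam = 30 r]
    the product with the [n ^ k <= exp (k d / 2)] permutations and with a net of
    [O(d)] of size [(C r^2) ^ (d^2)] is small as soon as [k >= c d] and
    [k >= 60 sigma^2 n].  Hence a maximum likelihood [pi] has few errors, and if
    [2 k <= n], then the smallest singular value of [X] restricted to the correct
    indices, which is of order [sqrt n] uniformly over subsets of size [n / 2],
    converts [gap <= 0] into [|Q - Qs|^2 <= C sigma^2 d]. *)

(** The exponential moment is available for one fixed [Q] only, and this shapes the count. Rounding
    [Q] to a net of mesh [1 / q] moves the gap by [O(n d / q)]; multiplied by [lam = 30 n / k] this
    stays below a small multiple of [k d] once [q] is a large multiple of [r ^ 2], whence the size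
    of the net. Its entropy is [d ^ 2 (O(1) + 2 ln r)]. Since [ln (1 + 15 r) >= 12 / 5 + ln r / 2],
    the moment is at most [exp (- 3 k d / 5 - k d ln r / 8)]: the logarithmic part pays for the
    [ln r] of the net when [k >= c d], and [3 / 5] exceeds the [1 / 2] that [d >= 2 ln n] grants to
    the permutations. The factor 60 comes from [lam sigma ^ 2 <= 1 / 2], which keeps half of the
    quadratic exponent after [Z] is integrated out. No cycle decomposition or determinant enters.
    Column [j] of [X] is compared with a rotation of column [tau j], where [tau] is [pi^-1] followed
    by [pis]; the [j] with [tau j < j] or those with [tau j > j] make up at least half of the
    errors, and along the matching order the quadratic form is triangular. *)

(** * Gaussian integrals of exponentials of quadratic polynomials *)

Section normal_integral.
Context {R : realType}.
Import HBNNSimple.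
Local Open Scope ereal_scope.

(** Extends a density formula from sets to nonnegative functions: indicators, simple functions,
    monotone limits. It turns integrals against [normal_prob] into Lebesgue integrals. *)
Lemma ge0_integral_density {dT} {T : measurableType dT}
    (mu nu : {measure set T -> \bar R}) (g : T -> R) (f : T -> \bar R) :
  measurable_fun setT g -> (forall x, (0 <= g x)%R) ->
  (forall A, measurable A -> nu A = \int[mu]_(x in A) (g x)%:E) ->
  measurable_fun setT f -> (forall x, 0 <= f x) ->
  \int[nu]_x f x = \int[mu]_x (f x * (g x)%:E).
Proof.
move=> mg g0 nug mf f0.
have indicE A : measurable A ->
    \int[nu]_x (\1_A x)%:E = \int[mu]_x ((\1_A x)%:E * (g x)%:E).
  move=> mA; rewrite integral_indic// setIT nug// integral_mkcond.
  apply: eq_integral => x _; rewrite patchE indicE.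
  by case: ifP => xA; rewrite ?mul1e ?mul0e.
have mEg : measurable_fun setT (EFin \o g) by exact/measurable_EFinP.
have nnsfunE (h : {nnsfun T >-> R}) :
    \int[nu]_x (h x)%:E = \int[mu]_x ((h x)%:E * (g x)%:E).
  under [LHS]eq_integral do rewrite fimfunE -fsumEFin//.
  rewrite [LHS]ge0_integral_fsum//; last 2 first.
  - by move=> r; exact/measurable_EFinP/measurableT_comp.
  - by move=> n x _; rewrite EFinM nnfun_muleindic_ge0.
  under [RHS]eq_integral.
    move=> x _; rewrite muleC fimfunE -fsumEFin// ge0_mule_fsumr; last first.
      by move=> r; rewrite EFinM nnfun_muleindic_ge0.
    over.
  rewrite [RHS]ge0_integral_fsum//; last 2 first.
  - by move=> r; apply: emeasurable_funM => //; apply/measurable_EFinP/measurableT_comp.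
  - by move=> n x _; apply: mule_ge0; [rewrite lee_fin//|rewrite EFinM nnfun_muleindic_ge0].
  apply: eq_fsbigr => r _.
  rewrite (integralZl_indic_nnsfun _ _ _)// indicE//.
  have [r0|r0] := ltP r 0%R.
    rewrite preimage_nnfun0//.
    under [X in _ * X]eq_integral do rewrite indic0 mul0e.
    under [RHS]eq_integral do rewrite indic0 mulr0 mule0.
    by rewrite !integral0 mule0.
  rewrite -ge0_integralZl//; last 2 first.
  - by apply: emeasurable_funM => //; exact/measurable_EFinP/measurable_indic.
  - by move=> x _; rewrite mule_ge0// lee_fin.
  by apply: eq_integral => x _; rewrite EFinM muleA muleC.
pose f_ := nnsfun_approx measurableT mf.
transitivity (lim (\int[nu]_x (f_ n x)%:E @[n --> \oo])).
  rewrite -monotone_convergence//=.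
  - apply: eq_integral => ? /[!inE] xD; apply/esym/cvg_lim => //=.
    exact: cvg_nnsfun_approx.
  - by move=> n; exact/measurable_EFinP/measurable_funTS.
  - by move=> n ? _; rewrite lee_fin.
  - by move=> ? _ ? ? mn; rewrite lee_fin; exact/lefP/nd_nnsfun_approx.
transitivity (lim (\int[mu]_x ((f_ n x)%:E * (g x)%:E) @[n --> \oo])).
  by apply: congr_lim; apply/funext => n; exact: nnsfunE.
rewrite -monotone_convergence//=.
- apply: eq_integral => x /[!inE] xD; apply/cvg_lim => //.
  apply: cvgeZr => //; exact: cvg_nnsfun_approx.
- by move=> n; apply: emeasurable_funM => //; exact/measurable_EFinP.
- by move=> n x _; rewrite mule_ge0 ?lee_fin.
- move=> x _ m n mn; apply: lee_wpmul2r; rewrite lee_fin//.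
  exact/lefP/nd_nnsfun_approx.
Qed.

End normal_integral.

Section normal_exponential.
Context {R : realType}.

(** Completing the square: up to a constant factor the new integrand is the normal density of mean
    [b / c] and variance [1 / c], with [c = 1 + 2 * g]. *)
Lemma normal_prob_exp_quadratic (a b g : R) : 0 < 1 + 2 * g ->
  (\int[normal_prob 0 1]_x (expR (a + b * x - g * x ^+ 2))%:E =
   (expR (a + b ^+ 2 / (2 * (1 + 2 * g)) - ln (1 + 2 * g) / 2))%:E)%E.
Proof.
move cE : (1 + 2 * g) => c c0.
have cs0 : 0 < Num.sqrt c by rewrite sqrtr_gt0.
have c2 : Num.sqrt c ^+ 2 = c by rewrite sqr_sqrtr// ltW.
pose s := (Num.sqrt c)^-1; pose m := b / c.
have s0 : s != 0 by rewrite invr_eq0 gt_eqF.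
have s2 : s ^+ 2 = c^-1 by rewrite exprVn c2.
have mexp : measurable_fun setT (fun x : R => (expR (a + b * x - g * x ^+ 2))%:E).
  apply/measurable_EFinP; apply: measurableT_comp => //.
  apply: measurable_funB.
    by apply: measurable_funD => //; exact: measurable_funM.
  by apply: measurable_funM => //; exact: exprn_measurable.
rewrite (@ge0_integral_density _ _ _ lebesgue_measure _ (normal_pdf 0 1))//;
  [|exact: measurable_normal_pdf|by move=> x; exact: normal_pdf_ge0].
pose K := expR (a + b ^+ 2 / (2 * c)) * s.
have KE : expR (a + b ^+ 2 / (2 * c) - ln c / 2) = K.
  rewrite expRD /K; congr (_ * _).
  apply: (@pexpIrn _ 2); rewrite ?nnegrE ?expR_ge0 ?invr_ge0 ?sqrtr_ge0//.
  rewrite s2 -expRM_natl (_ : 2 * _ = - ln c); last by field.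
  by rewrite expRN lnK.
rewrite KE; transitivity
    (\int[lebesgue_measure]_x (K%:E * (normal_pdf m s x)%:E))%E; last first.
  rewrite ge0_integralZl//; first by rewrite integral_normal_pdf mule1.
  - by apply/measurable_EFinP; exact: measurable_normal_pdf.
  - by move=> x _; rewrite lee_fin normal_pdf_ge0.
  - by rewrite lee_fin mulr_ge0 ?expR_ge0// invr_ge0 sqrtr_ge0.
apply: eq_integral => x _; rewrite -!EFinM; congr EFin.
rewrite !normal_pdfE ?oner_eq0// /normal_peak /normal_fun.
have -> : Num.sqrt (s ^+ 2 * pi *+ 2) = s * Num.sqrt (1 ^+ 2 * pi *+ 2).
  rewrite expr1n mul1r -mulrnAr sqrtrM ?sqr_ge0// sqrtr_sqr ger0_norm//.
  by rewrite invr_ge0 sqrtr_ge0.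
rewrite invfM /K.
set p := (Num.sqrt _)^-1.
rewrite !mulrA mulfK// -[LHS]mulrAC -[RHS]mulrAC -!expRD; congr (expR _ * _).
rewrite s2 expr1n subr0 /m.
have -> : g = (c - 1) / 2 by rewrite -cE; field.
by field; rewrite gt_eqF.
Qed.

End normal_exponential.

(** * Product sigma-algebra and resampling of one coordinate *)

Section resampling.
Context {R : realType} {K : finType}.

Definition rectangle (B : K -> set R) : set (K -> R) :=
  [set v | forall k, B k (v k)].

Definition measurable_rectangles : set_system (K -> R) :=
  [set A | exists2 B, (forall k, measurable (B k)) & A = rectangle B].

(** The product sigma-algebra, presented by rectangles: they form a pi-system, so a law is
    determined by its values on them, and [gaussian_design] prescribes exactly these. *)
Definition coordspace := g_sigma_algebraType measurable_rectangles.

HB.instance Definition _ := Measurable.on coordspace.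

Definition upd (v : K -> R) (k : K) (x : R) : K -> R :=
  fun j => if j == k then x else v j.

Lemma updE v k x : upd v k x k = x.
Proof. by rewrite /upd eqxx. Qed.

Lemma upd_neq v k x j : j != k -> upd v k x j = v j.
Proof. by rewrite /upd => /negbTE ->. Qed.

Lemma measurable_rectangle (B : K -> set R) : (forall k, measurable (B k)) ->
  measurable (rectangle B : set coordspace).
Proof. by move=> mB; apply: sub_sigma_algebra; exists B. Qed.

Lemma measurable_fun_coordspace d (T : measurableType d) (f : T -> coordspace) :
  (forall B, (forall k, measurable (B k)) -> measurable (f @^-1` rectangle B)) ->
  measurable_fun setT f.
Proof.
move=> mf; apply: (@measurability _ _ T coordspace setT f measurable_rectangles) => //.
by move=> _ [_ [B mB ->] <-]; rewrite setTI; exact: mf.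
Qed.

Lemma measurable_coord (k : K) : measurable_fun setT (fun v : coordspace => v k).
Proof.
move=> _ B mB; rewrite setTI.
pose C j : set R := if j == k then B else setT.
rewrite (_ : _ @^-1` B = rectangle C).
  by apply: measurable_rectangle => j; rewrite /C; case: ifP.
apply/seteqP; split=> [v Bv j|v Cv]; rewrite /C; first by case: eqP => // ->.
by have := Cv k; rewrite /C eqxx.
Qed.

Lemma measurable_upd (k : K) :
  measurable_fun setT (fun p : coordspace * R => upd p.1 k p.2 : coordspace).
Proof.
apply: measurable_fun_coordspace => B mB.
pose C j : set R := if j == k then setT else B j.
rewrite (_ : _ @^-1` _ = rectangle C `*` B k).
  apply: measurableX => //; apply: measurable_rectangle => j.
  by rewrite /C; case: ifP.
apply/seteqP; split=> [[v x] /= vB|[v x] [/= vC xB] j].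
  split; last by have := vB k; rewrite updE.
  by move=> j /=; rewrite /C; have := vB j; rewrite /upd; case: eqP.
by rewrite /upd; have := vC j; rewrite /C; case: eqP => // ->.
Qed.

Definition std_gaussian (nu : set coordspace -> \bar R) : Prop :=
  forall B : K -> set R, (forall k, measurable (B k)) ->
  nu (rectangle B) = (\prod_k normal_prob 0 1 (B k))%E.

Section integral.
Variable nu : probability coordspace R.
Hypothesis nuG : std_gaussian nu.

Let N : probability _ R := normal_prob (0:R) 1.

Let phi k := fun p : coordspace * R => upd p.1 k p.2 : coordspace.

Let setI_rect : setI_closed measurable_rectangles.
Proof.
move=> _ _ [B mB ->] [C mC ->]; exists (fun k => B k `&` C k).
  by move=> k; exact: measurableI.
apply/seteqP; split=> [v [vB vC] k|v vBC]; first by split; [exact: vB|exact: vC].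
by split=> k; have [] := vBC k.
Qed.

(** Overwriting coordinate [k] by an independent normal variable preserves [nu]. On a rectangle the
    [k]-th factor of [nu] becomes 1 and [N] supplies it again; rectangles suffice by uniqueness on a
    pi-system. *)
Let law_upd k (A : set coordspace) : measurable A ->
  nu A = pushforward (nu \x N)%E (phi k) A.
Proof.
have mphi := measurable_upd k.
pose mu2 : {measure set coordspace -> \bar R} :=
  measure_function_pushforward__canonical__measure_function_Measure (nu \x N)%E mphi.
move=> mA; rewrite -[RHS]/(mu2 A).
apply: (@measure_unique _ _ coordspace measurable_rectangles (fun=> setT) _ _ _ _ nu mu2) => //.
- move=> _; exists (fun=> setT) => //.
  by apply/seteqP; split.
- by apply/seteqP; split => // v _; exists 0%N.
- move=> _ [B mB ->]; transitivity (\prod_k N (B k))%E; first exact: nuG.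
  rewrite /mu2/= /pushforward.
  pose C j : set R := if j == k then setT else B j.
  rewrite (_ : _ @^-1` _ = rectangle C `*` B k); last first.
    apply/seteqP; split=> [[v x] /= vB|[v x] [/= vC xB] j].
      split; last by have := vB k; rewrite /phi updE.
      by move=> j /=; rewrite /C; have := vB j; rewrite /phi /upd; case: eqP.
    by rewrite /phi /upd; have := vC j; rewrite /C; case: eqP => // ->.
  have mC j : measurable (C j) by rewrite /C; case: ifP.
  rewrite product_measure1E//; [|exact: (@measurable_rectangle C)|exact: mB].
  rewrite [X in (X * _)%E](_ : _ = \prod_k N (C k))%E; last exact: nuG.
  rewrite (bigD1 k)//= [X in _ = (X * _)%E](bigD1 k)//=.
  rewrite {1}/C eqxx (@probability_setT _ _ _ N) mul1e muleC.
  congr (_ * _)%E; apply: eq_bigr => j jk; by rewrite /C (negbTE jk).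
- by move=> _; exact: (le_lt_trans (probability_le1 nu measurableT) (ltry _)).
Qed.

Lemma resampling k (f : coordspace -> \bar R) :
  measurable_fun setT f -> (forall v, 0 <= f v)%E ->
  (\int[nu]_v f v = \int[nu]_v \int[normal_prob 0 1]_x f (upd v k x : coordspace))%E.
Proof.
move=> mf f0.
have mphi := measurable_upd k.
pose mu2 : {measure set coordspace -> \bar R} :=
  measure_function_pushforward__canonical__measure_function_Measure (nu \x N)%E mphi.
rewrite (eq_measure_integral mu2); last by move=> A mA _; exact: law_upd.
rewrite ge0_integral_pushforward//= preimage_setT.
rewrite fubini_tonelli1//.
exact: (measurableT_comp mf mphi).
Qed.

End integral.
End resampling.

Lemma measurable_sum_cond {R : realType} d (T : measurableType d) (I : finType)
    (p : pred I) (F : I -> T -> R) : (forall i, measurable_fun setT (F i)) ->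
  measurable_fun setT (fun x => \sum_(i | p i) F i x).
Proof.
move=> mF; under eq_fun do rewrite -big_filter.
exact: measurable_sum.
Qed.

(** * Exponential moments, one coordinate at a time *)

Section gaussian_exponentials.
Context {R : realType} {K : finType}.
Local Notation V := (@coordspace R K).
Variable nu : probability V R.
Hypothesis nuG : std_gaussian nu.

Definition mexp (f : V -> R) : \bar R := (\int[nu]_v (expR (f v))%:E)%E.

(** Functional rather than probabilistic independence: [f] does not read coordinate [k], so it is a
    constant for the inner integral of [resampling]. *)
Definition indep_of {S : Type} (f : (K -> R) -> S) (k : K) : Prop :=
  forall v x, f (upd v k x) = f v.

Lemma eq_mexp (f g : V -> R) : f =1 g -> mexp f = mexp g.
Proof. by move=> fg; apply: eq_integral => v _; rewrite fg. Qed.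

Lemma measurable_expR_fun (f : V -> R) : measurable_fun setT f ->
  measurable_fun setT (fun v => (expR (f v))%:E).
Proof. by move=> mf; apply/measurable_EFinP; apply: measurableT_comp => //. Qed.

Lemma le_mexp (f g : V -> R) : measurable_fun setT f ->
  measurable_fun setT g -> (forall v, f v <= g v) -> (mexp f <= mexp g)%E.
Proof.
move=> mf mg fg; apply: ge0_le_integral => //.
- exact: measurable_expR_fun.
- exact: measurable_expR_fun.
- by move=> v _; rewrite lee_fin ler_expR.
Qed.

Lemma mexp_cst (c : R) : mexp (fun=> c) = (expR c)%:E.
Proof.
rewrite /mexp integral_cst// [X in (_ * X)%E](_ : _ = 1%E) ?mule1//.
exact: (probability_setT nu).
Qed.

Lemma mexpDr (f : V -> R) (c : R) : measurable_fun setT f ->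
  mexp (fun v => f v + c) = (mexp f * (expR c)%:E)%E.
Proof.
move=> mf; rewrite /mexp -ge0_integralZr//.
- by apply: eq_integral => v _; rewrite expRD EFinM.
- exact: measurable_expR_fun.
Qed.

Lemma mexp_quadratic (a b : V -> R) (g : R) (k : K) :
  measurable_fun setT a -> measurable_fun setT b ->
  indep_of a k -> indep_of b k -> 0 < 1 + 2 * g ->
  mexp (fun v => a v + b v * v k - g * v k ^+ 2) =
  mexp (fun v => a v + b v ^+ 2 / (2 * (1 + 2 * g)) - ln (1 + 2 * g) / 2).
Proof.
move=> ma mb ia ib g0; have mk := measurable_coord k.
have mf : measurable_fun setT (fun v : V => (expR (a v + b v * v k - g * v k ^+ 2))%:E).
  apply: measurable_expR_fun; apply: measurable_funB.
    by apply: measurable_funD ma _; exact: measurable_funM.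
  by apply: measurable_funM; [exact: measurable_cst|exact: measurable_funX].
rewrite {1}/mexp (resampling nuG k mf); last by move=> v; rewrite lee_fin expR_ge0.
apply: eq_integral => v _; rewrite -(normal_prob_exp_quadratic _ _ g0).
by apply: eq_integral => x _; rewrite ia ib updE.
Qed.

(** Iterates [mexp_quadratic] with [g = 0]. In use, [s] lists the coordinates of [Z], and [a] and
    [b] read only [X]. *)
Lemma mexp_linear (s : seq K) (b : K -> V -> R) (a : V -> R) :
  uniq s -> measurable_fun setT a -> (forall e, measurable_fun setT (b e)) ->
  (forall k, k \in s -> indep_of a k) ->
  (forall e k, k \in s -> indep_of (b e) k) ->
  mexp (fun v => a v + \sum_(e <- s) b e v * v e) =
  mexp (fun v => a v + (\sum_(e <- s) b e v ^+ 2) / 2).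
Proof.
move=> us ma mb ia ib; elim: s us a ma ia ib => [|e s IH] /=.
  by move=> _ a ma ia ib; apply: eq_mexp => v; rewrite !big_nil mul0r.
case/andP => es us a ma ia ib.
pose a' (v : V) := a v + \sum_(j <- s) b j v * v j.
have ma' : measurable_fun setT a'.
  apply: measurable_funD ma _; apply: measurable_sum => j.
  by apply: measurable_funM (mb j) _; exact: measurable_coord.
have ia' : indep_of a' e.
  move=> v x; rewrite /a' (ia _ (mem_head _ _)); congr (_ + _).
  apply: eq_big_seq => j js; rewrite (ib _ _ (mem_head _ _)) upd_neq//.
  by apply: contraNneq es => <-.
have g0 : 0 < 1 + 2 * (0 : R) by rewrite mulr0 addr0.
transitivity (mexp (fun v => a' v + b e v * v e - 0 * v e ^+ 2)).
  by apply: eq_mexp => v; rewrite big_cons mul0r subr0 /a' addrCA addrC.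
rewrite (mexp_quadratic ma' (mb e) ia' (ib e e (mem_head _ _)) g0).
pose a1 (v : V) := a v + b e v ^+ 2 / 2.
transitivity (mexp (fun v => a1 v + \sum_(j <- s) b j v * v j)).
  apply: eq_mexp => v; rewrite mulr0 addr0 ln1 mul0r subr0 mulr1 /a' /a1.
  by rewrite addrAC.
have ma1 : measurable_fun setT a1.
  apply: measurable_funD ma _; apply: measurable_funM; last exact: measurable_cst.
  exact: measurable_funX.
have ia1 k : k \in s -> indep_of a1 k.
  by move=> ks v x; rewrite /a1 ia ?ib ?inE ?ks ?orbT.
have ib1 j k : k \in s -> indep_of (b j) k.
  by move=> ks; apply: ib; rewrite inE ks orbT.
rewrite (IH us _ ma1 ia1 ib1).
by apply: eq_mexp => v; rewrite /a1 big_cons mulrDl addrA.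
Qed.

(* The coordinates in [J] are integrated out in decreasing order of [rk]: when
   the turn of [e] comes, [h e] and all remaining terms are already fixed. *)
Lemma mexp_sum_sqr_ranked (rk : K -> nat) (h : K -> V -> R) (t : R)
    (J : {set K}) : 0 <= t ->
  (forall e, measurable_fun setT (h e)) ->
  (forall e k, e \in J -> (rk e <= rk k)%N -> indep_of (h e) k) ->
  (mexp (fun v => - (t * \sum_(e in J) (v e - h e v) ^+ 2))%R <=
   (expR (- (#|J|%:R / 2 * ln (1 + 2 * t)))%R)%:E)%E.
Proof.
move=> t0 mh; move cJ : #|J| => m; elim: m J cJ => [|m IH] J cJ ih.
  have -> : J = finset.set0 by apply/eqP; rewrite -cards_eq0 cJ.
  rewrite !mul0r oppr0 -mexp_cst le_eqVlt; apply/orP; left; apply/eqP.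
  by apply: eq_mexp => v; rewrite big_set0 mulr0 oppr0.
have /card_gt0P[e0 e0J] : (0 < #|J|)%N by rewrite cJ.
have [e' eJ emax] := @arg_maxnP _ e0 (mem J) rk e0J.
move: e' eJ emax => e; rewrite -[mem J e]/(e \in J) => eJ emax.
have ihe : indep_of (h e) e by exact: ih.
pose a (v : V) := - (t * \sum_(j in J :\ e) (v j - h j v) ^+ 2).
have ma : measurable_fun setT a.
  apply: measurable_funN; apply: measurable_funM; first exact: measurable_cst.
  apply: measurable_sum_cond => j; apply: measurable_funX.
  by apply: measurable_funB (mh j); exact: measurable_coord.
have ia : indep_of a e.
  move=> v x; rewrite /a; congr (- (_ * _)).
  apply: eq_bigr => j; rewrite !inE => /andP[je jJ].
  by rewrite upd_neq// ih//; exact: emax.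
have t1 : 0 < 1 + 2 * t by rewrite ltr_pwDl// mulr_ge0.
apply: (@le_trans _ _ (mexp (fun v => a v + - (ln (1 + 2 * t) / 2)))); last first.
  rewrite (mexpDr _ ma).
  have cJ' : #|J :\ e| = m by move: cJ; rewrite (cardsD1 e) eJ => -[].
  have -> : - (m.+1%:R / 2 * ln (1 + 2 * t)) =
      - (m%:R / 2 * ln (1 + 2 * t)) + - (ln (1 + 2 * t) / 2).
    by rewrite -natr1; field.
  rewrite expRD EFinM; apply: lee_wpmul2r; first by rewrite lee_fin expR_ge0.
  by apply: IH cJ' _ => e' k; rewrite inE => /andP[_]; exact: ih.
pose a1 (v : V) := a v - t * h e v ^+ 2.
pose b1 (v : V) := 2 * t * h e v.
have ma1 : measurable_fun setT a1.
  apply: measurable_funB ma _; apply: measurable_funM; first exact: measurable_cst.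
  exact: measurable_funX.
have mb1 : measurable_fun setT b1.
  by apply: measurable_funM (mh e); exact: measurable_cst.
have ia1 : indep_of a1 e by move=> v x; rewrite /a1 ia ihe.
have ib1 : indep_of b1 e by move=> v x; rewrite /b1 ihe.
have -> : mexp (fun v => - (t * \sum_(j in J) (v j - h j v) ^+ 2)) =
    mexp (fun v => a1 v + b1 v * v e - t * v e ^+ 2).
  apply: eq_mexp => v; rewrite (big_setD1 e eJ)/= /a1 /b1 /a.
  by set S := \sum_(_ in _) _; ring.
rewrite (mexp_quadratic ma1 mb1 ia1 ib1 t1); apply: le_mexp.
- apply: measurable_funB; last exact: measurable_cst.
  apply: measurable_funD ma1 _; apply: measurable_funM; last exact: measurable_cst.
  exact: measurable_funX.
- by apply: measurable_funD ma _; exact: measurable_cst.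
(* Off-centre squares only help: the shift leaves [- (t * h e v ^+ 2 / (1 + 2 * t))], which is
   nonpositive and is dropped. *)
- move=> v; rewrite lerD2r /a1 -addrA gerDl.
  rewrite (_ : _ + _ = - (t * h e v ^+ 2 / (1 + 2 * t))); last first.
    by rewrite /b1; field; rewrite gt_eqF.
  by rewrite oppr_le0 divr_ge0 ?(ltW t1)// mulr_ge0 ?sqr_ge0.
Qed.

(** Integrating out one coordinate replaces [t] by [t / q] with [q = 1 + 2 * (t * c e ^+ 2)], and
    the logarithmic factors telescope. The offset [b] carries the coordinates still to be treated
    through the induction. Negative [t] is allowed, for upper tails. *)
Lemma mexp_sqr_linear (s : seq K) (c : K -> R) (a b : V -> R) (t : R) :
  uniq s -> measurable_fun setT a -> measurable_fun setT b ->
  (forall k, k \in s -> indep_of a k) -> (forall k, k \in s -> indep_of b k) ->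
  0 < 1 + 2 * (t * \sum_(e <- s) c e ^+ 2) ->
  mexp (fun v => a v - t * (b v + \sum_(e <- s) c e * v e) ^+ 2) =
  mexp (fun v => a v - t * b v ^+ 2 / (1 + 2 * (t * \sum_(e <- s) c e ^+ 2))
                 - ln (1 + 2 * (t * \sum_(e <- s) c e ^+ 2)) / 2).
Proof.
elim: s t a b => [|e s IH] t a b.
  move=> _ _ _ _ _ _; apply: eq_mexp => v.
  by rewrite !big_nil !mulr0 !addr0 ln1 mul0r divr1 subr0.
case/andP => es us ma mb ia ib; rewrite !big_cons; set S := \sum_(e <- s) _ => t0.
have S0 : 0 <= S by apply: sumr_ge0 => j _; exact: sqr_ge0.
(* For negative [t] this follows from [t0], because one coordinate has at most the total
   variance. *)
have e0 : 0 < 1 + 2 * (t * c e ^+ 2).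
  have [t_ge0|t_lt0] := leP 0 t.
    by rewrite ltr_pwDl// mulr_ge0// mulr_ge0// sqr_ge0.
  apply: (lt_le_trans t0); rewrite lerD2l ler_pM2l// ler_nM2l// lerDl//.
set q := 1 + 2 * (t * c e ^+ 2) in e0 *.
have qE : 1 + 2 * (t / q * S) = (1 + 2 * (t * (c e ^+ 2 + S))) / q.
  by rewrite /q; field; rewrite -/q gt_eqF.
have q0 : 0 < 1 + 2 * (t / q * S) by rewrite qE divr_gt0.
pose b1 (v : V) := b v + \sum_(j <- s) c j * v j.
pose a1 (v : V) := a v - t * b1 v ^+ 2.
pose d1 (v : V) := - (2 * t * c e) * b1 v.
pose a2 (v : V) := a v - ln q / 2.
have mb1 : measurable_fun setT b1.
  apply: measurable_funD mb _; apply: measurable_sum => j.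
  by apply: measurable_funM; [exact: measurable_cst|exact: measurable_coord].
have ma1 : measurable_fun setT a1.
  apply: measurable_funB ma _; apply: measurable_funM; first exact: measurable_cst.
  exact: measurable_funX.
have md1 : measurable_fun setT d1.
  by apply: measurable_funM mb1; exact: measurable_cst.
have ma2 : measurable_fun setT a2.
  by apply: measurable_funB ma _; exact: measurable_cst.
have ib1 : indep_of b1 e.
  move=> v x; rewrite /b1 (ib _ (mem_head _ _)); congr (_ + _).
  apply: eq_big_seq => j js; rewrite upd_neq//.
  by apply: contraNneq es => <-.
have ia1 : indep_of a1 e by move=> v x; rewrite /a1 ib1 (ia _ (mem_head _ _)).
have id1 : indep_of d1 e by move=> v x; rewrite /d1 ib1.
have ia2 k : k \in s -> indep_of a2 k.
  by move=> ks v x; rewrite /a2 ia// inE ks orbT.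
have ibs k : k \in s -> indep_of b k.
  by move=> ks; apply: ib; rewrite inE ks orbT.
transitivity (mexp (fun v => a1 v + d1 v * v e - (t * c e ^+ 2) * v e ^+ 2)).
  apply: eq_mexp => v; rewrite big_cons /a1 /d1 /b1.
  by set T := \sum_(_ <- _) _; ring.
rewrite (mexp_quadratic ma1 md1 ia1 id1 e0) -/q.
transitivity (mexp (fun v => a2 v - t / q * (b v + \sum_(j <- s) c j * v j) ^+ 2)).
  apply: eq_mexp => v; rewrite -/(b1 v) /a1 /a2 /d1.
  have : q != 0 by rewrite gt_eqF.
  rewrite /q; set L := ln _; set B := b1 v => q1.
  by field.
rewrite (IH (t / q) a2 b us ma2 mb ia2 ibs q0).
apply: eq_mexp => v; rewrite -/S qE /a2 ln_div ?posrE//.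
set L := ln q; set M := ln _; set A := 1 + _ in t0 *.
by field; rewrite !gt_eqF.
Qed.

End gaussian_exponentials.

(** * Chernoff and union bounds *)

Section tails.
Context {R : realType} {K : finType}.
Local Notation V := (@coordspace R K).
Variable nu : probability V R.

Lemma measurable_ge0_set (f : V -> R) : measurable_fun setT f ->
  measurable [set v | 0 <= f v].
Proof.
move=> mf; rewrite (_ : [set _ | _] = setT `&` f @^-1` `[0, +oo[%classic).
  by apply: mf => //; exact: measurable_itv.
by rewrite setTI; apply/seteqP; split => v /=; rewrite in_itv/= andbT.
Qed.

Lemma chernoff_mexp (f : V -> R) : measurable_fun setT f ->
  (nu [set v | (0 <= f v)%R] <= mexp nu f)%E.
Proof.
move=> mf; have mA := measurable_ge0_set mf.
rewrite -[in leLHS](setIT [set v | _]) -integral_indic//.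
apply: ge0_le_integral => //.
- exact/measurable_EFinP/measurable_indic.
- exact: measurable_expR_fun.
- move=> v _; rewrite lee_fin indicE; case: (boolP (v \in _)) => vA.
    by rewrite -expR0 ler_expR; move: vA; rewrite inE.
  exact: expR_ge0.
Qed.

Lemma boole_seq (I : eqType) (s : seq I) (B : I -> set V) (r : I -> R) :
  (forall i, i \in s -> measurable (B i)) ->
  (forall i, i \in s -> nu (B i) <= (r i)%:E)%E ->
  measurable [set v | exists2 i, i \in s & B i v] /\
  (nu [set v | exists2 i, i \in s & B i v] <= (\sum_(i <- s) r i)%:E)%E.
Proof.
elim: s => [|i s IH] mB Br.
  rewrite (_ : [set _ | _] = classical_sets.set0).
    by rewrite big_nil measure0.
  by apply/seteqP; split => v //= [].
have [||ms les] := IH.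
- by move=> j js; apply: mB; rewrite inE js orbT.
- by move=> j js; apply: Br; rewrite inE js orbT.
have mi : measurable (B i) by apply: mB; rewrite mem_head.
rewrite (_ : [set _ | _] = B i `|` [set v | exists2 i, i \in s & B i v]).
  split; first exact: measurableU.
  apply: (le_trans (measureU2 _ mi ms)); rewrite big_cons EFinD; apply: leeD => //.
  by apply: Br; rewrite mem_head.
apply/seteqP; split=> v /= => [[j]|[Biv|[j js Bjv]]].
- by rewrite inE => /predU1P[->|js] Bjv; [left|right; exists j].
- by exists i; rewrite ?mem_head.
- by exists j; rewrite ?inE ?js ?orbT.
Qed.

(** Deviation levels and Laplace parameters are absorbed into [f], so every bad event reads
    [0 <= f i v]. Returning a set [B] keeps measurability separate from the conclusion on its
    complement. *)
Lemma union_chernoff (I : eqType) (s : seq I) (f : I -> V -> R) (r : R) :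
  (forall i, measurable_fun setT (f i)) ->
  (forall i, i \in s -> mexp nu (f i) <= r%:E)%E ->
  exists B, [/\ measurable B, (nu B <= ((size s)%:R * r)%:E)%E &
    forall v, ~ B v -> forall i, i \in s -> f i v < 0].
Proof.
move=> mf fr.
have [||mB leB] := @boole_seq I s (fun i => [set v | 0 <= f i v]) (fun=> r).
- by move=> i _; exact: measurable_ge0_set.
- by move=> i si; exact: (le_trans (chernoff_mexp (mf i))) (fr i si).
eexists; split; [exact: mB| |].
  by apply: (le_trans leB); rewrite big_const_seq count_predT iter_addr_0 mulr_natl.
by move=> v nBv i si; rewrite ltNge; apply/negP => fi; apply: nBv; exists i.
Qed.

End tails.

(** * Projections of the sample columns *)

Section samples.
Context {R : realType} {d n : nat}.
Local Notation K := (bool * 'I_d * 'I_n)%type.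
Local Notation V := (@coordspace R K).
Variable nu : probability V R.
Hypothesis nuG : std_gaussian nu.

(** Inner product of [u] with column [i] of [X] ([b = true]) or of [Z] ([b = false]). *)
Definition sproj (b : bool) (u : 'I_d -> R) (v : K -> R) (i : 'I_n) : R :=
  \sum_l u l * v (b, l, i).

Lemma measurable_proj b u i : measurable_fun setT (fun v : V => sproj b u v i).
Proof.
apply: measurable_sum => l.
by apply: measurable_funM; [exact: measurable_cst|exact: measurable_coord].
Qed.

Lemma proj_indep b u i k : k.2 != i -> indep_of (fun v => sproj b u v i) k.
Proof.
move=> ki v x; apply: eq_bigr => l _; rewrite upd_neq//.
by apply: contraNneq ki => <-.
Qed.

(** Along a unit vector the projections are independent standard normals, so this is the Laplace
    transform of a chi-square law. It serves with [t < 0] for the largest singular value and [t > 0]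
    for the smallest. *)
Lemma mexp_sum_sqr_proj b (u : 'I_d -> R) (t : R) (A : {set 'I_n}) :
  0 < 1 + 2 * t -> \sum_l u l ^+ 2 = 1 ->
  mexp nu (fun v => - (t * \sum_(i in A) sproj b u v i ^+ 2)) =
  (expR (- (#|A|%:R / 2 * ln (1 + 2 * t))))%:E.
Proof.
move=> t1 u1.
transitivity (mexp nu (fun v => - (t * \sum_(i <- enum A) sproj b u v i ^+ 2))).
  by apply: eq_mexp => v; rewrite -big_enum.
rewrite cardE; elim: (enum A) (enum_uniq A) => [|i s IH] /=.
  move=> _; rewrite !mul0r oppr0 -(mexp_cst nu); apply: eq_mexp => v.
  by rewrite big_nil mulr0 oppr0.
case/andP => si us.
pose a (v : V) := - (t * \sum_(j <- s) sproj b u v j ^+ 2).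
pose ks : seq K := [seq (b, l, i) | l <- enum 'I_d].
pose c (e : K) := u e.1.2.
have uks : uniq ks by rewrite map_inj_uniq ?enum_uniq// => l l' [].
have ma : measurable_fun setT a.
  apply: measurable_funN; apply: measurable_funM; first exact: measurable_cst.
  by apply: measurable_sum => j; apply: measurable_funX; exact: measurable_proj.
have m0 : measurable_fun setT (fun _ : V => 0 : R) by exact: measurable_cst.
have ia k : k \in ks -> indep_of a k.
  move=> /mapP[l _ ->] v x; rewrite /a; congr (- (_ * _)).
  apply: eq_big_seq => j js; rewrite proj_indep//=.
  by apply: contraNneq si => ->.
have i0 k : k \in ks -> indep_of (fun _ : K -> R => 0 : R) k by [].
have cE : \sum_(e <- ks) c e ^+ 2 = 1 by rewrite big_map big_enum/= -u1.
have projE v : \sum_(e <- ks) c e * v e = sproj b u v i by rewrite big_map big_enum.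
have t1' : 0 < 1 + 2 * (t * \sum_(e <- ks) c e ^+ 2) by rewrite cE mulr1.
transitivity (mexp nu (fun v => a v - t * (0 + \sum_(e <- ks) c e * v e) ^+ 2)).
  by apply: eq_mexp => v; rewrite projE big_cons /a add0r; ring.
rewrite (mexp_sqr_linear nuG uks ma m0 ia i0 t1') cE mulr1.
transitivity (mexp nu (fun v => a v + - (ln (1 + 2 * t) / 2))).
  by apply: eq_mexp => v; rewrite expr0n/= mulr0 mul0r subr0.
rewrite (mexpDr _ _ ma) (IH us) -EFinM -expRD -natr1; congr (expR _)%:E.
by field.
Qed.

End samples.

(** * The gap and its exponential moment *)

Section gap.
Context {R : realType} {d n : nat}.
Local Notation K := (bool * 'I_d * 'I_n)%type.
Local Notation V := (@coordspace R K).
Variables (Qs : 'M[R]_d) (pis : 'S_n) (sigma : R).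

Lemma orthogonal_mxC (Q : 'M[R]_d) : orthogonal_mx Q -> Q^T *m Q = 1%:M.
Proof. exact: mulmx1C. Qed.

Lemma sqnormE (y : 'cV[R]_d) : sqnorm y = (y^T *m y) 0 0.
Proof. by rewrite mxE; apply: eq_bigr => k _; rewrite mxE expr2. Qed.

Lemma sqnorm_orthogonal (Q : 'M[R]_d) (y : 'cV[R]_d) :
  orthogonal_mx Q -> sqnorm (Q *m y) = sqnorm y.
Proof.
move=> /orthogonal_mxC oQ.
by rewrite !sqnormE trmx_mul mulmxA -(mulmxA y^T) oQ mulmx1.
Qed.

(** Noiseless part of the rotated residual: coordinate [k] of [Q x_(pi i) - y_i] is [dev] minus
    [sigma] times the noise coordinate. *)
Definition dev (Q : 'M[R]_d) (pi : 'S_n) (v : K -> R) (i : 'I_n) (k : 'I_d) : R :=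
  sproj true (Q k) v (pi i) - sproj true (Qs k) v (pis i).

(* [n / 2] times the excess loss of [(pi, Q)] over [(pis, Qs)]. *)
Definition gap (Q : 'M[R]_d) (pi : 'S_n) (v : K -> R) : R :=
  2^-1 * (\sum_i \sum_k dev Q pi v i k ^+ 2) -
  sigma * \sum_i \sum_k dev Q pi v i k * v (false, k, i).

Lemma measurable_dev Q pi i k : measurable_fun setT (fun v : V => dev Q pi v i k).
Proof. by apply: measurable_funB; exact: measurable_proj. Qed.

Lemma measurable_gap Q pi : measurable_fun setT (gap Q pi : V -> R).
Proof.
have mc (c : R) : measurable_fun setT (fun _ : V => c) by exact: measurable_cst.
apply: measurable_funB; apply: measurable_funM => //;
  apply: measurable_sum => i; apply: measurable_sum => k.
- by apply: measurable_funX; exact: measurable_dev.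
- by apply: measurable_funM (measurable_dev _ _ _ _) _; exact: measurable_coord.
Qed.

Definition xcol (v : K -> R) (i : 'I_n) : 'cV[R]_d := \col_l v (true, l, i).

Lemma projE (Q : 'M[R]_d) v i k : sproj true (Q k) v i = (Q *m xcol v i) k 0.
Proof. by rewrite mxE; apply: eq_bigr => l _; rewrite mxE. Qed.

Lemma devE Q pi v i k :
  dev Q pi v i k = (Q *m xcol v (pi i) - Qs *m xcol v (pis i)) k 0.
Proof. by rewrite /dev !projE [RHS]mxE [X in _ = _ + X]mxE. Qed.

(** Rotating by [Q^T] and reindexing by [j = pi i] isolates a bare coordinate of column [j], minus a
    function of column [tau j]: the shape required by [mexp_sum_sqr_ranked]. *)
Lemma sum_sqr_dev (Q : 'M[R]_d) (pi : 'S_n) v : orthogonal_mx Q ->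
  \sum_i \sum_k dev Q pi v i k ^+ 2 =
  \sum_j \sum_l (v (true, l, j) -
                 sproj true ((Q^T *m Qs) l) v ((pi^-1 * pis)%g j)) ^+ 2.
Proof.
move=> oQ; rewrite [RHS](reindex_inj (@perm_inj _ pi)) /=.
apply: eq_bigr => i _; rewrite permM permK.
transitivity (sqnorm (Q *m (xcol v (pi i) - Q^T *m Qs *m xcol v (pis i)))).
  apply: eq_bigr => k _; rewrite devE; congr ((_ : 'cV_d) k 0 ^+ 2).
  by rewrite mulmxBr !mulmxA oQ mul1mx.
rewrite sqnorm_orthogonal//; apply: eq_bigr => l _; congr (_ ^+ 2).
by rewrite [LHS]mxE [X in _ + X]mxE -projE mxE.
Qed.

Definition errors (pi : 'S_n) : {set 'I_n} := [set i | pi i != pis i]%SET.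

Section bound.
Variable nu : probability V R.
Hypothesis nuG : std_gaussian nu.

Let coordT (p : 'I_n * 'I_d) : K := (true, p.2, p.1).

(** If the rank drops along [tau] on [S], the term of column [j] reads only itself and a column of
    smaller rank, so the form is triangular on [S]; squares outside [S] are discarded. *)
Lemma mexp_sum_sqr_dev (Q : 'M[R]_d) (pi : 'S_n) (t : R) (S : {set 'I_n})
    (rk : 'I_n -> nat) : 0 <= t -> orthogonal_mx Q ->
  (forall j, j \in S -> (rk ((pi^-1 * pis)%g j) < rk j)%N) ->
  (mexp nu (fun v => - (t * \sum_i \sum_k dev Q pi v i k ^+ 2))%R <=
   (expR (- ((#|S| * d)%:R / 2 * ln (1 + 2 * t)))%R)%:E)%E.
Proof.
move=> t0 oQ rkS; pose H := Q^T *m Qs; pose tau := (pi^-1 * pis)%g.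
have coordT_inj : injective coordT by move=> [i k] [j l] [-> ->].
pose J : {set K} := coordT @: (finset.setX S [set: 'I_d])%SET.
pose h (e : K) (v : K -> R) := sproj true (H e.1.2) v (tau e.2).
have mh e : measurable_fun setT (h e : V -> R) by exact: measurable_proj.
have cJ : #|J| = (#|S| * d)%N by rewrite card_imset// cardsX cardsT card_ord.
rewrite -cJ; apply: le_trans (mexp_sum_sqr_ranked nuG (rk := fun e => rk e.2) t0 mh _).
- apply: le_mexp.
  + apply: measurable_funN; apply: measurable_funM; first exact: measurable_cst.
    apply: measurable_sum => i; apply: measurable_sum => k.
    by apply: measurable_funX; exact: measurable_dev.
  + apply: measurable_funN; apply: measurable_funM; first exact: measurable_cst.
    apply: measurable_sum_cond => i; apply: measurable_funX.
    by apply: measurable_funB (mh i); exact: measurable_coord.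
  + move=> v; rewrite lerN2; apply: ler_wpM2l => //.
    rewrite sum_sqr_dev// pair_big/= big_imset/=; last by move=> ? ? _ _; exact: coordT_inj.
    rewrite [leRHS](bigID (mem (finset.setX S [set: 'I_d])%SET))/= lerDl.
    by apply: sumr_ge0 => p _; exact: sqr_ge0.
- move=> e k /imsetP[[j l]]; rewrite !inE /= andbT => jS -> rkk.
  apply: proj_indep; apply: contraTneq rkk => ->; rewrite -ltnNge /=.
  exact: rkS.
Qed.

Lemma mexp_gap (Q : 'M[R]_d) (pi : 'S_n) (lam : R) : 0 <= lam ->
  lam * sigma ^+ 2 <= 2^-1 -> orthogonal_mx Q ->
  (mexp nu (fun v => - (lam * gap Q pi v))%R <=
   (expR (- ((#|errors pi| * d)%:R / 4 * ln (1 + lam / 2)))%R)%:E)%E.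
Proof.
move=> lam0 lams oQ.
pose s : seq K := [seq (false, p.2, p.1) | p <- enum {: 'I_n * 'I_d}].
have us : uniq s by rewrite map_inj_uniq ?enum_uniq// => -[i k] [j l] [-> ->].
pose A (v : V) := \sum_i \sum_k dev Q pi v i k ^+ 2.
pose a (v : V) := - (lam / 2 * A v).
pose b (e : K) (v : V) := lam * sigma * dev Q pi v e.2 e.1.2.
have mc (c : R) : measurable_fun setT (fun _ : V => c) by exact: measurable_cst.
have mA : measurable_fun setT A.
  apply: measurable_sum => i; apply: measurable_sum => k.
  by apply: measurable_funX; exact: measurable_dev.
have ma : measurable_fun setT a.
  by apply: measurable_funN; exact: measurable_funM (mc _) mA.
have mb e : measurable_fun setT (b e).
  by apply: measurable_funM (mc _) _; exact: measurable_dev.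
have devF k i l : k \in s -> indep_of (fun v => dev Q pi v i l) k.
  move=> /mapP[p _ ->] v x; congr (_ - _);
  by apply: eq_bigr => m _; rewrite upd_neq.
have ia k : k \in s -> indep_of a k.
  move=> ks v x; rewrite /a /A; congr (- (_ * _)).
  by apply: eq_bigr => i _; apply: eq_bigr => l _; rewrite devF.
have ib e k : k \in s -> indep_of (b e) k.
  by move=> ks v x; rewrite /b devF.
have sumE (F : K -> R) : \sum_(e <- s) F e = \sum_i \sum_k F (false, k, i).
  by rewrite big_map big_enum/= pair_big.
have -> : mexp nu (fun v => - (lam * gap Q pi v)) =
    mexp nu (fun v => a v + \sum_(e <- s) b e v * v e).
  apply: eq_mexp => v; rewrite sumE /a /gap -/(A v).
  have -> : \sum_i \sum_k b (false, k, i) v * v (false, k, i) =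
      lam * sigma * \sum_i \sum_k dev Q pi v i k * v (false, k, i).
    rewrite mulr_sumr; apply: eq_bigr => i _; rewrite mulr_sumr.
    by apply: eq_bigr => k _; rewrite /b/= mulrA.
  by set B := \sum_i _; field.
rewrite (mexp_linear nuG us ma mb ia ib).
(* Integrating out [Z] has cost [(lam * sigma) ^+ 2 * A / 2], at most [lam * A / 4] by the
   hypothesis on [lam * sigma ^+ 2]; half of [lam * A / 2] survives. *)
apply: (@le_trans _ _ (mexp nu (fun v => - (lam / 4 * A v)))).
  apply: le_mexp.
  - apply: measurable_funD ma _; apply: measurable_funM (mc _).
    by apply: measurable_sum => e; exact: measurable_funX.
  - by apply: measurable_funN; exact: measurable_funM (mc _) mA.
  - move=> v; rewrite sumE /a.
    have -> : \sum_i \sum_k b (false, k, i) v ^+ 2 = lam * (lam * sigma ^+ 2) * A v.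
      rewrite /A mulr_sumr; apply: eq_bigr => i _; rewrite mulr_sumr.
      by apply: eq_bigr => k _; rewrite /b/=; ring.
    have A0 : 0 <= A v by apply: sumr_ge0 => ? _; apply: sumr_ge0 => ? _; exact: sqr_ge0.
    have : lam * (lam * sigma ^+ 2) * A v <= lam * 2^-1 * A v.
      by apply: ler_wpM2r => //; exact: ler_wpM2l.
    by move: (A v) => x; lra.
(* Fixed points of [tau] correspond to correct matches, so the errors split into its descents [S1]
   and ascents [S2]. The larger class is kept, ranked by the natural order for [S1] and by the
   reversed order for [S2]. *)
pose tau := (pi^-1 * pis)%g.
pose S1 : {set 'I_n} := [set j : 'I_n | (tau j < j)%N]%SET.
pose S2 : {set 'I_n} := [set j : 'I_n | (j < tau j)%N]%SET.
have cS : #|errors pi| = (#|S1| + #|S2|)%N.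
  have -> : errors pi = pi @^-1: (S1 :|: S2).
    apply/setP => i; rewrite !inE /tau permM permK -neq_ltn eq_sym.
    by rewrite (inj_eq val_inj).
  rewrite card_preimset; last exact: perm_inj.
  rewrite cardsU (_ : S1 :&: S2 = finset.set0) ?cards0 ?subn0//.
  apply/setP => j; rewrite !inE; apply/negP => /andP[h1 h2].
  by have := ltn_trans h1 h2; rewrite ltnn.
have lam4 : 0 <= lam / 4 by rewrite divr_ge0.
have key (S : {set 'I_n}) (rk : 'I_n -> nat) : (#|errors pi| <= 2 * #|S|)%N ->
    (forall j, j \in S -> (rk (tau j) < rk j)%N) ->
    (mexp nu (fun v => - (lam / 4 * A v))%R <=
     (expR (- ((#|errors pi| * d)%:R / 4 * ln (1 + lam / 2)))%R)%:E)%E.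
  move=> eS rkS; apply: le_trans (mexp_sum_sqr_dev lam4 oQ rkS) _.
  rewrite lee_fin ler_expR lerN2.
  have -> : 2 * (lam / 4) = lam / 2 by field.
  apply: ler_wpM2r.
    by rewrite ln_ge0// lerDl divr_ge0.
  have : (#|errors pi| * d)%:R <= 2 * (#|S| * d)%:R :> R.
    by rewrite -natrM ler_nat mulnA leq_mul2r eS orbT.
  lra.
case: (leqP #|S2| #|S1|) => S12.
- apply: (key S1 (fun j => j)); first by rewrite cS mul2n -addnn leq_add2l.
  by move=> j; rewrite inE.
- apply: (key S2 (fun j => n - j)%N).
    by rewrite cS mul2n -addnn leq_add2r ltnW.
  by move=> j; rewrite inE => jt; apply: ltn_sub2l => //; exact: ltn_ord.
Qed.

End bound.
End gap.

(** * Nets of bounded sets in Euclidean space *)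

Section nets.
Context {R : realType}.

Lemma sum_expr_le (w : R) (m : nat) : 0 <= w -> w < 1 ->
  \sum_(i < m) w ^+ i <= (1 - w)^-1.
Proof.
move=> w0 w1; rewrite -[leRHS]mul1r ler_pdivlMr ?subr_gt0//.
have := subrX1 w m; rewrite -opprB => /eqP; rewrite eqr_oppLR => /eqP.
rewrite -mulNr opprB mulrC => <-.
by rewrite gerBl exprn_ge0.
Qed.

(** Exponential weights: each admissible [l] has weight at least 1 under
    [w ^- (q * D) * \prod_i w ^+ (l i).2], and the total weight factorizes over [I]. With
    [w = q / (q + 1)] one has [w ^- q <= e] and [(1 - w)^-1 = q + 1]; the factor 2 counts signs. *)
Lemma card_bounded_sum (I : finType) (q : nat) : (0 < q)%N ->
  (#|[set l : {ffun I -> bool * 'I_(q * #|I|).+1} |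
      (\sum_i (l i).2 <= q * #|I|)%N]%SET|)%:R
  <= (2 * expR 1 * q.+1%:R) ^+ #|I| :> R.
Proof.
move=> q0; set D := #|I|; set G := [set l | _]%SET.
pose w : R := q%:R / q.+1%:R.
have q1 : 0 < q.+1%:R :> R by rewrite ltr0n.
have q0' : 0 < q%:R :> R by rewrite ltr0n.
have w0 : 0 < w by rewrite divr_gt0.
have w1 : w < 1 by rewrite ltr_pdivrMr// mul1r ltr_nat.
have wq : w ^- q <= expR 1.
  rewrite -exprVn /w invf_div -natr1 mulrDl divff ?gt_eqF// mul1r.
  apply: (@le_trans _ _ (expR (q%:R^-1) ^+ q)).
    apply: lerXn2r; rewrite ?nnegrE ?expR_ge0 ?expR_ge1Dx//.
  by rewrite -expRM_natl divff// gt_eqF.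
have wV : (1 - w)^-1 = q.+1%:R.
  have -> : 1 - w = q.+1%:R^-1; last by rewrite invrK.
  by rewrite /w -natr1; field; rewrite natr1 gt_eqF.
apply: (@le_trans _ _ (\sum_(l : {ffun I -> bool * 'I_(q * D).+1})
    (w ^- (q * D) * \prod_i w ^+ (l i).2))).
  rewrite -sum1_card natr_sum [leLHS](big_mkcond (fun l => l \in G))/=.
  apply: ler_sum => l _; rewrite prodrXr.
  case: ifP => [|_]; last by rewrite mulr_ge0 ?invr_ge0 ?exprn_ge0// ltW.
  rewrite inE => lG; rewrite mulrC ler_pdivlMr ?exprn_gt0// mul1r.
  by rewrite ler_wiXn2l// ltW.
rewrite -mulr_sumr -(bigA_distr_bigA (fun (_ : I) (p : bool * 'I_(q * D).+1) => w ^+ p.2)).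
rewrite prodr_const -/D exprM -exprVn -exprMn.
have -> : \sum_(p : bool * 'I_(q * D).+1) w ^+ p.2 = 2 * \sum_(j < (q * D).+1) w ^+ j.
  rewrite -(pair_bigA _ (fun (_ : bool) (j : 'I_(q * D).+1) => w ^+ j))/=.
  by rewrite sumr_const card_bool mulr_natl.
have S0 : 0 <= \sum_(j < (q * D).+1) w ^+ j.
  by apply: sumr_ge0 => j _; rewrite exprn_ge0// ltW.
have wV0 : 0 <= w ^- q by rewrite invr_ge0 exprn_ge0// ltW.
apply: lerXn2r; rewrite ?nnegrE.
- by rewrite mulr_ge0// mulr_ge0.
- by rewrite mulr_ge0// mulr_ge0// expR_ge0.
rewrite mulrCA -[leRHS]mulrA ler_wpM2l// ler_pM// -wV; apply: sum_expr_le => //; exact: ltW.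
Qed.

(* A net is obtained by choosing one representative of each cell of the grid
   given by the signs and the integer parts of [q * sqrt #|I| / rho * `|a i|]. *)
Lemma exists_net (I : finType) (O : set (I -> R)) (rho : R) (q : nat) :
  0 < rho -> (0 < q)%N -> (0 < #|I|)%N ->
  (forall a, O a -> \sum_i a i ^+ 2 <= rho ^+ 2) ->
  exists (m : nat) (N : 'I_m -> I -> R),
    [/\ m%:R <= (2 * expR 1 * q.+1%:R) ^+ #|I| :> R,
        forall j, O (N j)
      & forall a, O a -> exists j, \sum_(i : I) (a i - N j i) ^+ 2 <= (rho / q%:R) ^+ 2].
Proof.
move=> rho0 q0 I0 Orho; set D := #|I| in I0 *.
have D0 : 0 < Num.sqrt D%:R :> R by rewrite sqrtr_gt0 ltr0n.
have D2 : Num.sqrt D%:R ^+ 2 = D%:R :> R by rewrite sqr_sqrtr// ler0n.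
have q0' : 0 < q%:R :> R by rewrite ltr0n.
pose c : R := q%:R * (Num.sqrt D%:R / rho).
have c0 : 0 < c by rewrite mulr_gt0// divr_gt0.
have ca0 a (i : I) : 0 <= c * `|a i : R| by rewrite mulr_ge0// ltW.
pose M := (q * D)%N.
(* By [y <= (1 + y ^+ 2) / 2] with [y] the entry scaled by [Num.sqrt D / rho], the labels sum to at
   most [q * D]. This bound on the sum keeps the net exponential in [D]. *)
have sumM a : O a -> (\sum_i Num.truncn (c * `|a i : R|) <= M)%N.
  move=> Oa; rewrite -(ler_nat R) natr_sum.
  apply: (@le_trans _ _ (\sum_i (q%:R / 2 * (1 + D%:R / rho ^+ 2 * a i ^+ 2)))).
    apply: ler_sum => i _; apply: (@le_trans _ _ (c * `|a i|)).
      by rewrite truncn_le ca0.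
    have -> : D%:R / rho ^+ 2 * a i ^+ 2 = (Num.sqrt D%:R / rho * `|a i|) ^+ 2.
      by rewrite !exprMn real_normK ?num_real// D2 exprVn.
    rewrite /c -!mulrA ler_pM2l// mulrA; set y := _ * `|a i|.
    by have := sqr_ge0 (y - 1); rewrite sqrrB mulr1 expr1n; lra.
  rewrite -mulr_sumr big_split/= sumr_const -/D -mulr_sumr.
  have DDr : D%:R / rho ^+ 2 * (\sum_i a i ^+ 2) <= D%:R.
    by rewrite -mulrA ler_piMr// mulrC ler_pdivrMr ?exprn_gt0// mul1r Orho.
  have -> : M%:R = q%:R / 2 * (D%:R + D%:R) :> R by rewrite natrM; field.
  by rewrite ler_pM2l ?divr_gt0// lerD2l.
have leM a i : O a -> (Num.truncn (c * `|a i : R|) <= M)%N.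
  by move=> Oa; apply: leq_trans (sumM a Oa); rewrite (bigD1 i)//= leq_addr.
pose L := {ffun I -> bool * 'I_M.+1}.
pose lab (a : I -> R) : L := [ffun i => (0 <= a i, inord (Num.truncn (c * `|a i|)))].
pose hit : {set L} := [set l | `[< exists2 a, O a & lab a = l >]]%SET.
have hitP (j : 'I_#|hit|) : exists a, O a /\ lab a = enum_val j.
  by have := enum_valP j; rewrite inE => /asboolP[a Oa la]; exists a.
have [N NP] := choice hitP.
exists #|hit|, N; split.
- apply: le_trans (card_bounded_sum I q0); rewrite ler_nat.
  apply: subset_leq_card; apply/fintype.subsetP => l; rewrite !inE.
  move=> [a Oa <-]; apply: leq_trans (sumM a Oa).
  by apply: leq_sum => i _; rewrite ffunE/= inordK// ltnS leM.
- by move=> j; have [] := NP j.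
- move=> a Oa; have ah : lab a \in hit by rewrite inE; apply/asboolP; exists a.
  exists (enum_rank_in ah (lab a)).
  have := NP (enum_rank_in ah (lab a)); move: (N _) => b [Ob].
  rewrite enum_rankK_in// => lb.
  apply: (@le_trans _ _ (\sum_(i : I) (c^-1) ^+ 2)); last first.
    rewrite sumr_const -/D le_eqVlt; apply/orP; left; apply/eqP.
    have E (s : R) : 0 < s ->
        (q%:R * (s / rho))^-1 ^+ 2 * s ^+ 2 = (rho / q%:R) ^+ 2.
      by move=> s0; field; rewrite !gt_eqF.
    by rewrite -(E _ D0) D2 mulr_natr.
  apply: ler_sum => i _.
  have := congr1 (fun l : L => l i) lb; rewrite !ffunE => -[sE /(congr1 val)/=].
  rewrite !inordK ?ltnS ?leM// => tE.
  rewrite -[leLHS]real_normK ?num_real// lerXn2r ?nnegrE ?invr_ge0 ?(ltW c0)//.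
  rewrite -[c^-1]mul1r ler_pdivlMr// mulrC -[c in c * _]gtr0_norm// -normrM mulrBr.
  have abE : `|c * a i - c * b i| = `|c * `|a i| - c * `|b i| |.
    case: (leP 0 (a i)) sE => a0 b0.
      by rewrite (ger0_norm a0) (ger0_norm b0).
    have b0' : b i < 0 by rewrite ltNge b0.
    by rewrite (ltr0_norm a0) (ltr0_norm b0') !mulrN -opprD normrN.
  rewrite abE ler_norml; have := truncn_itv (ca0 a i); have := truncn_itv (ca0 b i).
  rewrite tE -natr1 => /andP[b1 b2] /andP[a1 a2].
  by apply/andP; split; lra.
Qed.

End nets.

(** * Nets of the sphere and of O(d), and extension from nets to all vectors *)

Section deterministic_bounds.
Context {R : realType}.

Lemma sum_cauchy_schwarz (I : finType) (a b : I -> R) :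
  (\sum_i a i * b i) ^+ 2 <= (\sum_i a i ^+ 2) * (\sum_i b i ^+ 2).
Proof.
set A := \sum_i a i ^+ 2; set B := \sum_i b i ^+ 2; set P := \sum_i a i * b i.
have A0 : 0 <= A by apply: sumr_ge0 => i _; exact: sqr_ge0.
have : 0 <= \sum_i (A * b i - P * a i) ^+ 2 by apply: sumr_ge0 => i _; exact: sqr_ge0.
have -> : \sum_i (A * b i - P * a i) ^+ 2 = A * (A * B - P ^+ 2).
  rewrite (eq_bigr (fun i => A ^+ 2 * b i ^+ 2 - 2 * A * P * (a i * b i) +
    P ^+ 2 * a i ^+ 2)); last by move=> i _; ring.
  by rewrite big_split sumrB/= -!mulr_sumr -/A -/B -/P; ring.
have [A1|A1] := eqVneq A 0.
  have aE i : a i = 0.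
    apply/eqP; rewrite -sqrf_eq0; apply/eqP.
    apply: (psumr_eq0P _ A1) => // j _; exact: sqr_ge0.
  have -> : P = 0 by rewrite /P big1// => i _; rewrite aE mul0r.
  by rewrite A1 !mul0r expr0n.
by rewrite pmulr_rge0 ?subr_ge0// lt_def A1.
Qed.

Lemma sphere_net (d q : nat) : (0 < d)%N -> (0 < q)%N ->
  exists (m : nat) (N : 'I_m -> 'I_d -> R),
    [/\ m%:R <= (2 * expR 1 * q.+1%:R) ^+ d :> R,
        forall j, \sum_l N j l ^+ 2 = 1
      & forall u : 'I_d -> R, \sum_l u l ^+ 2 = 1 ->
        exists j, \sum_(l < d) (u l - N j l) ^+ 2 <= q%:R ^- 2].
Proof.
move=> d0 q0.
have cd : (0 < #|'I_d|)%N by rewrite card_ord.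
have le1 (a : 'I_d -> R) : \sum_l a l ^+ 2 = 1 -> \sum_l a l ^+ 2 <= 1 ^+ 2.
  by move=> ->; rewrite expr1n.
have [m [N [mN N1 Nu]]] := @exists_net R 'I_d
  [set u | \sum_l u l ^+ 2 = 1] 1 q ltr01 q0 cd le1.
exists m, N; split=> //; first by rewrite card_ord in mN.
by move=> u /Nu[j]; rewrite mul1r exprVn => ?; exists j.
Qed.

Lemma sum_sqr_orthogonal_mx (d : nat) (Q : 'M[R]_d) : orthogonal_mx Q ->
  \sum_i \sum_j Q i j ^+ 2 = d%:R.
Proof.
move=> oQ; rewrite -(mxtrace1 R d) -oQ; apply: eq_bigr => i _.
by rewrite mxE; apply: eq_bigr => j _; rewrite mxE expr2.
Qed.

(** Orthogonal matrices lie on the Frobenius sphere of radius [Num.sqrt d] in dimension [d * d]. The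
    net points are themselves orthogonal, as [mexp_gap] requires. *)
Lemma orthogonal_net (d q : nat) : (0 < d)%N -> (0 < q)%N ->
  exists (m : nat) (N : 'I_m -> 'M[R]_d),
    [/\ m%:R <= (2 * expR 1 * q.+1%:R) ^+ (d * d) :> R,
        forall j, orthogonal_mx (N j)
      & forall Q : 'M[R]_d, orthogonal_mx Q ->
        exists j, ell2 Q (N j) <= d%:R / q%:R ^+ 2].
Proof.
move=> d0 q0; pose mx (a : 'I_d * 'I_d -> R) : 'M[R]_d := \matrix_(i, j) a (i, j).
have d0' : 0 < Num.sqrt d%:R :> R by rewrite sqrtr_gt0 ltr0n.
have d2 : Num.sqrt d%:R ^+ 2 = d%:R :> R by rewrite sqr_sqrtr// ler0n.
have cd : (0 < #|{: 'I_d * 'I_d}|)%N by rewrite card_prod card_ord muln_gt0 d0.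
have led a : orthogonal_mx (mx a) -> \sum_p a p ^+ 2 <= Num.sqrt d%:R ^+ 2.
  move=> oa; rewrite d2 -(sum_sqr_orthogonal_mx oa) pair_bigA/= le_eqVlt.
  apply/orP; left; apply/eqP; apply: eq_bigr => -[i j] _; by rewrite mxE.
have [m [N [mN N1 NQ]]] := @exists_net R ('I_d * 'I_d)%type
  [set a | orthogonal_mx (mx a)] (Num.sqrt d%:R) q d0' q0 cd led.
exists m, (fun j => mx (N j)); split=> //; first by rewrite card_prod card_ord in mN.
move=> Q oQ; have [|j] := NQ (fun p => Q p.1 p.2).
  by rewrite /= (_ : mx _ = Q)//; apply/matrixP => i j; rewrite mxE.
rewrite exprMn d2 exprVn => le; exists j; apply: le_trans le.
rewrite /ell2 pair_bigA/= le_eqVlt; apply/orP; left; apply/eqP.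
by apply: eq_bigr => -[i k] _; rewrite mxE.
Qed.

Section samples.
Variables (d n : nat).
Local Notation K := (bool * 'I_d * 'I_n)%type.
Implicit Types (u : 'I_d -> R) (v : K -> R) (b : bool) (F : {set 'I_n}).

(** The quadratic form whose extreme values on the unit sphere are the squared extreme singular
    values of the matrix restricted to the columns in [F]. *)
Definition energy b v F u : R := \sum_(i in F) sproj b u v i ^+ 2.

Lemma energyZ b v F (c : R) u :
  energy b v F (fun l => c * u l) = c ^+ 2 * energy b v F u.
Proof.
rewrite /energy mulr_sumr; apply: eq_bigr => i _; rewrite -exprMn; congr (_ ^+ 2).
by rewrite /sproj mulr_sumr; apply: eq_bigr => l _; rewrite mulrA.
Qed.

Lemma energyB b v F u u' :
  energy b v F u <= 2 * energy b v F u' + 2 * energy b v F (fun l => u l - u' l).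
Proof.
rewrite /energy !mulr_sumr -big_split; apply: ler_sum => i _ /=.
have -> : sproj b (fun l => u l - u' l) v i = sproj b u v i - sproj b u' v i.
  by rewrite /sproj -sumrB; apply: eq_bigr => l _; rewrite mulrBl.
set x := sproj _ u _ _; set y := sproj _ u' _ _.
by have := sqr_ge0 (x - 2 * y); rewrite !sqrrB; lra.
Qed.

Lemma energy_setT b v F u : energy b v F u <= energy b v [set: 'I_n] u.
Proof.
rewrite /energy [leRHS](bigID (mem F))/=.
rewrite [X in _ <= X + _](eq_bigl (mem F)); last by move=> i; rewrite inE.
by rewrite lerDl sumr_ge0// => i _; exact: sqr_ge0.
Qed.

Lemma sphere_homogeneous (f : ('I_d -> R) -> R) (C : R) :
  (forall c u, f (fun l => c * u l) = c ^+ 2 * f u) ->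
  (forall u, \sum_l u l ^+ 2 = 1 -> f u <= C) ->
  forall u, f u <= C * \sum_l u l ^+ 2.
Proof.
move=> fZ fC u; have S0 : 0 <= \sum_l u l ^+ 2.
  by apply: sumr_ge0 => l _; exact: sqr_ge0.
have [S1|S1] := eqVneq (\sum_l u l ^+ 2) 0.
  rewrite S1 mulr0; have -> : u = fun l => 0 * u l.
    apply/funext => l; rewrite mul0r; apply/eqP; rewrite -sqrf_eq0; apply/eqP.
    by apply: (psumr_eq0P _ S1) => // j _; exact: sqr_ge0.
  by rewrite fZ expr0n/= mul0r.
have Sp : 0 < \sum_l u l ^+ 2 by rewrite lt_def S1.
set s := Num.sqrt (\sum_l u l ^+ 2).
have s0 : 0 < s by rewrite sqrtr_gt0.
have s2 : s ^+ 2 = \sum_l u l ^+ 2 by rewrite sqr_sqrtr.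
have := fC (fun l => s^-1 * u l).
rewrite fZ exprVn s2 mulrC ler_pdivrMr//; apply.
by under eq_bigr => l _ do rewrite exprMn; rewrite -mulr_sumr exprVn s2 mulVf.
Qed.

Definition op_bound b v (C : R) : Prop :=
  forall u, energy b v [set: 'I_n] u <= C * \sum_l u l ^+ 2.

(** Mesh [1 / 2] improves a bound [B] to [2 * C + B / 2], with fixed point [4 * C]. Iterating from
    the crude Frobenius bound [B0] and passing to the limit avoids any supremum over the sphere. *)
Lemma op_bound_net b v (C : R) (m : nat) (N : 'I_m -> 'I_d -> R) : 0 <= C ->
  (forall u, \sum_l u l ^+ 2 = 1 ->
    exists j, \sum_l (u l - N j l) ^+ 2 <= 2 ^- 2) ->
  (forall j, energy b v [set: 'I_n] (N j) <= C) ->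
  op_bound b v (4 * C).
Proof.
move=> C0 Nnet NC.
have step B : 0 <= B -> op_bound b v B -> op_bound b v (2 * C + B / 2).
  move=> B0 vB; apply: sphere_homogeneous; first exact: energyZ.
  move=> u /Nnet[j uj]; apply: (le_trans (energyB _ _ _ _ (N j))).
  have := NC j; have := vB (fun l => u l - N j l).
  move: (energy _ _ _ (N j)) (energy _ _ _ (fun _ => _)) => x y.
  have : B * (\sum_l (u l - N j l) ^+ 2) <= B * 2 ^- 2 by exact: ler_wpM2l.
  move: (B * (\sum_l _)) => z.
  by rewrite (_ : B * 2 ^- 2 = B / 4); [lra|field].
have iter_step k B : 0 <= B -> op_bound b v B -> op_bound b v (4 * C + B / 2 ^+ k).
  move=> B0 vB; elim: k => [|k IH].
    move=> u; apply: (le_trans (vB u)); rewrite expr0 divr1 ler_wpM2r//.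
      by apply: sumr_ge0 => l _; exact: sqr_ge0.
    by rewrite lerDr mulr_ge0.
  have := step _ _ IH; rewrite (_ : _ + _ / 2 = 4 * C + B / 2 ^+ k.+1).
    by apply; rewrite addr_ge0 ?mulr_ge0// invr_ge0 exprn_ge0.
  by rewrite exprS; field; rewrite expf_neq0.
pose B0 := \sum_(i in [set: 'I_n]%SET) \sum_l v (b, l, i) ^+ 2.
have B00 : 0 <= B0 by apply: sumr_ge0 => i _; apply: sumr_ge0 => l _; exact: sqr_ge0.
have vB0 : op_bound b v B0.
  move=> u; rewrite /B0 mulr_suml; apply: ler_sum => i _; rewrite mulrC.
  exact: sum_cauchy_schwarz.
move=> u; set S := \sum_l u l ^+ 2.
have S0 : 0 <= S by apply: sumr_ge0 => l _; exact: sqr_ge0.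
apply/ler_addgt0Pr => e e0.
pose k := (Num.truncn (B0 * S / e)).+1.
apply: (le_trans (iter_step k _ B00 vB0 u)); rewrite -/S mulrDl lerD2l.
rewrite mulrAC ler_pdivrMr ?exprn_gt0// [leRHS]mulrC -ler_pdivrMr//.
apply: (@le_trans _ _ k%:R).
  by apply: ltW; apply: truncnS_gt.
by rewrite -natrX ler_nat ltnW// ltn_expl.
Qed.

(** Rounding to mesh [1 / q] changes the vector by an energy at most [S * n / q ^ 2 <= c * n], so
    [4 * c * n] at the net point is at most twice the energy of [u] plus [2 * c * n]. *)
Lemma energy_lower_net v F (S c : R) (q m : nat) (N : 'I_m -> 'I_d -> R) :
  op_bound true v (S * n%:R) -> 0 <= S -> (0 < q)%N -> S <= c * q%:R ^+ 2 ->
  (forall u, \sum_l u l ^+ 2 = 1 ->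
    exists j, \sum_l (u l - N j l) ^+ 2 <= q%:R ^- 2) ->
  (forall j, 4 * c * n%:R <= energy true v F (N j)) ->
  forall u, c * n%:R * \sum_l u l ^+ 2 <= energy true v F u.
Proof.
move=> vS S0 q0 Sq Nnet Nc u.
rewrite -lerN2 -mulNr.
apply: (sphere_homogeneous (f := fun u => - energy true v F u)).
  by move=> a w; rewrite energyZ mulrN.
move=> {}u /Nnet[j uj]; rewrite lerN2.
have q0' : 0 < q%:R :> R by rewrite ltr0n.
have := energyB true v F (N j) u; have := Nc j.
have n0 : 0 <= n%:R :> R by exact: ler0n.
have : energy true v F (fun l => N j l - u l) <= c * n%:R.
  apply: (le_trans (energy_setT _ _ _ _)).
  apply: (le_trans (vS _)).
  have -> : \sum_l (N j l - u l) ^+ 2 = \sum_l (u l - N j l) ^+ 2.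
    by apply: eq_bigr => l _; rewrite -sqrrN opprB.
  apply: (@le_trans _ _ (S * n%:R * q%:R ^- 2)).
    by apply: ler_wpM2l => //; rewrite mulr_ge0.
  by rewrite mulrAC ler_wpM2r// ler_pdivrMr ?exprn_gt0.
move: (energy _ _ _ (fun _ => _)) (energy _ _ _ (N j)) (energy _ _ _ u) => x y z.
by rewrite -mulrA; move: (c * n%:R) => p; lra.
Qed.

Lemma op_bound_mx b v (C : R) (A : 'M[R]_d) : op_bound b v C ->
  \sum_i \sum_k sproj b (A k) v i ^+ 2 <= C * \sum_k \sum_l A k l ^+ 2.
Proof.
move=> vC; rewrite exchange_big/= mulr_sumr; apply: ler_sum => k _.
apply: le_trans (vC (A k)); rewrite /energy le_eqVlt; apply/orP; left; apply/eqP.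
by apply: eq_bigl => i; rewrite inE.
Qed.

Lemma op_bound_frobenius b v (C : R) : op_bound b v C ->
  \sum_i \sum_k v (b, k, i) ^+ 2 <= C * d%:R.
Proof.
move=> /(op_bound_mx (1%:M)); rewrite sum_sqr_orthogonal_mx; last first.
  by rewrite /orthogonal_mx trmx1 mulmx1.
congr (_ <= _); apply: eq_bigr => i _; apply: eq_bigr => k _; congr (_ ^+ 2).
rewrite /sproj (bigD1 k)//= mxE eqxx mul1r big1 ?addr0// => l lk.
by rewrite mxE eq_sym (negbTE lk) mul0r.
Qed.

End samples.
End deterministic_bounds.

(** * Deterministic consequences for a maximum likelihood pair *)

Section maximum_likelihood.
Context {R : realType} {d n : nat}.
Local Notation K := (bool * 'I_d * 'I_n)%type.
Variables (Qs : 'M[R]_d) (pis : 'S_n) (sigma : R).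
Implicit Types (v : K -> R) (Q : 'M[R]_d) (pi : 'S_n).

Lemma sum_sproj_perm v Q pi (C : R) : op_bound true v C ->
  \sum_i \sum_k sproj true (Q k) v (pi i) ^+ 2 <= C * \sum_k \sum_l Q k l ^+ 2.
Proof.
move=> vC; apply: le_trans (op_bound_mx Q vC).
by rewrite [leRHS](reindex_inj (@perm_inj _ pi)).
Qed.

(** The rounding error has total square at most [C * d / q ^ 2], the quantities it multiplies
    [O(C * d)]; Young's inequality with weights [q] and [1 / q] balances them at [C * d / q]. The
    constant 6 bounds [3 / 4 + 6 * (3 / 4) + 1 / 2]. *)
Lemma gap_perturbation v Q Q' pi (C : R) (q : nat) :
  orthogonal_mx Qs -> orthogonal_mx Q -> orthogonal_mx Q' ->
  op_bound true v C -> op_bound false v C -> 0 <= C -> 0 <= sigma <= 1 ->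
  (0 < q)%N -> ell2 Q Q' <= d%:R / q%:R ^+ 2 ->
  gap Qs pis sigma Q' pi v - 6 * (C * d%:R) / q%:R <= gap Qs pis sigma Q pi v.
Proof.
move=> oQs oQ oQ' vX vZ C0 /andP[s0 s1] q0 QQ'.
have q0' : 0 < q%:R :> R by rewrite ltr0n.
pose p : R := q%:R^-1; have p0 : 0 < p by rewrite invr_gt0.
have pq : p * q%:R = 1 by rewrite mulVf// gt_eqF.
pose a i k := sproj true (Q k) v (pi i).
pose a' i k := sproj true (Q' k) v (pi i).
pose y i k := sproj true (Qs k) v (pis i).
pose z i k := v (false, k, i).
pose S2 (f : 'I_n -> 'I_d -> R) := \sum_i \sum_k f i k.
have S2D f g : S2 f + S2 g = S2 (fun i k => f i k + g i k).
  by rewrite /S2 -big_split; apply: eq_bigr => i _; rewrite -big_split.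
have S2Z c f : c * S2 f = S2 (fun i k => c * f i k).
  by rewrite /S2 mulr_sumr; apply: eq_bigr => i _; rewrite mulr_sumr.
pose T1 := S2 (fun i k => (a' i k - a i k) ^+ 2).
pose T2 := S2 (fun i k => a i k ^+ 2).
pose T3 := S2 (fun i k => a' i k ^+ 2).
pose T4 := S2 (fun i k => y i k ^+ 2).
pose T5 := S2 (fun i k => z i k ^+ 2).
have gE (b : 'I_n -> 'I_d -> R) : 2^-1 * S2 (fun i k => (b i k - y i k) ^+ 2) -
    sigma * S2 (fun i k => (b i k - y i k) * z i k) =
    S2 (fun i k => 2^-1 * (b i k - y i k) ^+ 2 - sigma * ((b i k - y i k) * z i k)).
  by rewrite -mulNr !S2Z S2D; apply: eq_bigr => i _; apply: eq_bigr => k _; ring.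
have key : gap Qs pis sigma Q' pi v - gap Qs pis sigma Q pi v <=
    3 / 4 * q%:R * T1 + 3 / 4 * p * (T2 + T3 + 4 * T4) + p / 2 * T5.
  rewrite /gap [X in X - _](gE a') [X in _ - X](gE a) -[X in _ + X]mulN1r.
  rewrite /T1 /T2 /T3 /T4 /T5 !(S2Z, S2D).
  apply: ler_sum => i _.
  apply: ler_sum => k _.
  move: (a i k) (a' i k) (y i k) (z i k) => A A' Y W.
  have h1 : 0 <= p * (q%:R * (A' - A) - (A + A' - 2 * Y)) ^+ 2.
    by rewrite mulr_ge0 ?sqr_ge0// ltW.
  have h2 : 0 <= sigma * (p * (q%:R * (A' - A) + W) ^+ 2).
    by rewrite mulr_ge0// mulr_ge0 ?sqr_ge0// ltW.
  have h3 : 0 <= p * (3 * (A ^+ 2 + A' ^+ 2 + 4 * Y ^+ 2) - (A + A' - 2 * Y) ^+ 2).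
    rewrite mulr_ge0 ?(ltW p0)//.
    have -> : 3 * (A ^+ 2 + A' ^+ 2 + 4 * Y ^+ 2) - (A + A' - 2 * Y) ^+ 2 =
      (A - A') ^+ 2 + (A + 2 * Y) ^+ 2 + (A' + 2 * Y) ^+ 2 by ring.
    by rewrite !addr_ge0// sqr_ge0.
  have h4 : 0 <= (1 - sigma) * (q%:R * (A' - A) ^+ 2 + p * W ^+ 2).
    by rewrite mulr_ge0 ?subr_ge0// addr_ge0// mulr_ge0 ?sqr_ge0// ltW.
  have e1 : p * (q%:R * (A' - A) - (A + A' - 2 * Y)) ^+ 2 =
      q%:R * (A' - A) ^+ 2 - 2 * (A' - A) * (A + A' - 2 * Y)
      + p * (A + A' - 2 * Y) ^+ 2.
    by rewrite /p; field; rewrite gt_eqF.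
  have e2 : p * (q%:R * (A' - A) + W) ^+ 2 =
      q%:R * (A' - A) ^+ 2 + 2 * (A' - A) * W + p * W ^+ 2.
    by rewrite /p; field; rewrite gt_eqF.
  rewrite e1 in h1; rewrite e2 in h2.
  rewrite -subr_ge0.
  (* Certificate: the difference of the two sides is a combination of [h1], ..., [h4] with positive
     coefficients. *)
  have -> : 3 / 4 * q%:R * (A' - A) ^+ 2
      + (3 / 4 * p * (A ^+ 2 + A' ^+ 2 + 4 * Y ^+ 2)) + p / 2 * W ^+ 2 -
      (2^-1 * (A' - Y) ^+ 2 - sigma * ((A' - Y) * W) +
       -1 * (2^-1 * (A - Y) ^+ 2 - sigma * ((A - Y) * W))) =
    4^-1 * (q%:R * (A' - A) ^+ 2 - 2 * (A' - A) * (A + A' - 2 * Y)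
      + p * (A + A' - 2 * Y) ^+ 2) +
    4^-1 * (p * (3 * (A ^+ 2 + A' ^+ 2 + 4 * Y ^+ 2) - (A + A' - 2 * Y) ^+ 2)) +
    2^-1 * (sigma * (q%:R * (A' - A) ^+ 2 + 2 * (A' - A) * W + p * W ^+ 2)) +
    2^-1 * ((1 - sigma) * (q%:R * (A' - A) ^+ 2 + p * W ^+ 2)) by field.
  by rewrite !addr_ge0// mulr_ge0.
have n0 : 0 <= C * d%:R by rewrite mulr_ge0.
have hT1 : T1 <= C * (d%:R / q%:R ^+ 2).
  apply: (@le_trans _ _ (C * ell2 Q Q')); last exact: ler_wpM2l.
  have := sum_sproj_perm (Q' - Q) pi vX; rewrite /ell2 /T1.
  congr (_ <= _ * _); last first.
    apply: eq_bigr => i _; apply: eq_bigr => j _.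
    by rewrite !mxE -sqrrN opprB.
  apply: eq_bigr => i _; apply: eq_bigr => k _; congr (_ ^+ 2).
  by rewrite /a /a' /sproj -sumrB; apply: eq_bigr => l _; rewrite !mxE mulrBl.
have hT2 : T2 <= C * d%:R by rewrite -(sum_sqr_orthogonal_mx oQ); exact: sum_sproj_perm.
have hT3 : T3 <= C * d%:R by rewrite -(sum_sqr_orthogonal_mx oQ'); exact: sum_sproj_perm.
have hT4 : T4 <= C * d%:R by rewrite -(sum_sqr_orthogonal_mx oQs); exact: sum_sproj_perm.
have hT5 : T5 <= C * d%:R by exact: op_bound_frobenius.
have g1 : q%:R * T1 <= p * (C * d%:R).
  apply: (@le_trans _ _ (q%:R * (C * (d%:R / q%:R ^+ 2)))).
    by apply: ler_wpM2l => //; exact: ltW.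
  by rewrite le_eqVlt; apply/orP; left; apply/eqP; rewrite /p; field; rewrite gt_eqF.
have g2 : p * (T2 + T3 + 4 * T4) <= p * (6 * (C * d%:R)).
  by apply: ler_wpM2l; [exact: ltW|lra].
have g3 : p * T5 <= p * (C * d%:R) by apply: ler_wpM2l => //; exact: ltW.
have pn0 : 0 <= p * (C * d%:R) by rewrite mulr_ge0// ltW.
rewrite -/p [_ / _]mulrC.
move: key g1 g2 g3 pn0; rewrite -/p.
move: (gap _ _ _ Q' _ _) (gap _ _ _ Q _ _) (T2 + T3 + 4 * T4) => G G' T.
rewrite -!mulrA; move: (C * d%:R) => x.
rewrite [p * (6 * x)]mulrCA [p * (2^-1 * T5)]mulrCA.
move: (p * x) (p * T) (p * T5) (q%:R * T1) => *; lra.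
Qed.

Lemma mle_lossE v Q pi : orthogonal_mx Q ->
  let X := \matrix_(k < d, i < n) v (true, k, i) in
  let Z := \matrix_(k < d, i < n) v (false, k, i) in
  mle_loss X (obs_matrix Qs pis sigma X Z) pi Q =
  n%:R^-1 * \sum_i \sum_k (dev Qs pis Q pi v i k - sigma * v (false, k, i)) ^+ 2.
Proof.
move=> oQ X Z; rewrite /mle_loss; congr (_ * _); apply: eq_bigr => i _.
rewrite -(sqnorm_orthogonal _ oQ) mulmxBr mulmxA oQ mul1mx.
have XE j : col j X = xcol v j by apply/matrixP => l k; rewrite !mxE.
apply: eq_bigr => k _; rewrite XE devE !mxE; congr (_ ^+ 2).
by rewrite XE opprD addrA.
Qed.

(** Minimality is applied to the planted pair, whose residual is pure noise; the squared noise
    cancels. *)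
Lemma mle_gap v Q pi : orthogonal_mx Qs -> (0 < n)%N ->
  let X := \matrix_(k < d, i < n) v (true, k, i) in
  let Z := \matrix_(k < d, i < n) v (false, k, i) in
  is_mle X (obs_matrix Qs pis sigma X Z) pi Q -> gap Qs pis sigma Q pi v <= 0.
Proof.
move=> oQs n0 X Z [oQ /(_ pis Qs oQs)].
rewrite !mle_lossE// ler_pM2l ?invr_gt0 ?ltr0n//.
rewrite -subr_le0 -sumrB /gap => le0.
rewrite -(pmulr_rle0 _ (ltr0n R 2)) mulrBr mulrA divff ?pnatr_eq0// mul1r.
apply: le_trans le0; rewrite le_eqVlt; apply/orP; left; apply/eqP.
rewrite !mulr_sumr -sumrB; apply: eq_bigr => i _.
rewrite !mulr_sumr -!sumrB; apply: eq_bigr => k _.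
have -> : dev Qs pis Qs pis v i k = 0 by rewrite /dev subrr.
by ring.
Qed.

(** On correct indices [dev] is [(Q - Qs) x], so [A] dominates [c * n * ell2 Qs Q]; and [gap <= 0]
    with Young's inequality gives [A / 2 <= A / 4 + sigma ^ 2 * |Z| ^ 2]. The set [F] depends on the
    data through [pi], hence the lower bound uniform over subsets. *)
Lemma gap_ell2 v Q pi (C c : R) : orthogonal_mx Qs -> orthogonal_mx Q ->
  gap Qs pis sigma Q pi v <= 0 -> op_bound false v C ->
  (forall (F : {set 'I_n}) u, (n <= 2 * #|F|)%N ->
    c * n%:R * \sum_l u l ^+ 2 <= energy true v F u) ->
  (2 * #|errors pis pi| <= n)%N ->
  c * n%:R * ell2 Qs Q <= 4 * sigma ^+ 2 * (C * d%:R).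
Proof.
move=> oQs oQ g0 vZ low err.
pose F := pis @: (~: errors pis pi).
have cF : (n <= 2 * #|F|)%N.
  rewrite card_imset; last exact: perm_inj.
  have := cardsC (errors pis pi); rewrite card_ord; move: err.
  by move: #|_| #|_| => x y; lia.
pose A := \sum_i \sum_k dev Qs pis Q pi v i k ^+ 2.
have hA : c * n%:R * ell2 Qs Q <= A.
  rewrite /ell2 mulr_sumr /A exchange_big/=; apply: ler_sum => k _.
  apply: (@le_trans _ _ (energy true v F (fun l => Q k l - Qs k l))).
    apply: le_trans (low _ _ cF); rewrite le_eqVlt; apply/orP; left; apply/eqP.
    by congr (_ * _); apply: eq_bigr => l _; rewrite -sqrrN opprB.
  rewrite /energy big_imset/=; last by move=> ? ? _ _; exact: perm_inj.
  rewrite [leRHS](bigID (mem (~: errors pis pi)))/= -[leLHS]addr0 lerD//; last first.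
    by apply: sumr_ge0 => i _; exact: sqr_ge0.
  apply: ler_sum => i; rewrite !inE negbK => /eqP E.
  rewrite le_eqVlt; apply/orP; left; apply/eqP; congr (_ ^+ 2).
  by rewrite /dev E /sproj -sumrB; apply: eq_bigr => l _; rewrite mulrBl.
apply: (le_trans hA) => {hA}.
have hZ : \sum_i \sum_k v (false, k, i) ^+ 2 <= C * d%:R by exact: op_bound_frobenius.
have : sigma * (\sum_i \sum_k dev Qs pis Q pi v i k * v (false, k, i)) <=
    4^-1 * A + sigma ^+ 2 * \sum_i \sum_k v (false, k, i) ^+ 2.
  rewrite /A !mulr_sumr -big_split/=; apply: ler_sum => i _.
  rewrite !mulr_sumr -big_split/=; apply: ler_sum => k _.
  move: (dev _ _ _ _ _ _ _) (v _) => x y.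
  have := sqr_ge0 (x - 2 * (sigma * y)).
  rewrite (_ : (x - _) ^+ 2 = 4 * (4^-1 * x ^+ 2 + sigma ^+ 2 * y ^+ 2 - sigma * (x * y)));
    last by field.
  by rewrite pmulr_rge0// subr_ge0.
have : sigma ^+ 2 * (\sum_i \sum_k v (false, k, i) ^+ 2) <= sigma ^+ 2 * (C * d%:R).
  by apply: ler_wpM2l => //; exact: sqr_ge0.
move: g0; rewrite /gap -/A -mulrA.
move: A (sigma * _) (sigma ^+ 2 * _) (sigma ^+ 2 * _) => *; lra.
Qed.

Lemma ov_errors pi : (0 < n)%N ->
  ov R pis pi = 1 - #|errors pis pi|%:R / n%:R.
Proof.
move=> n0; have n0' : n%:R != 0 :> R by rewrite pnatr_eq0 -lt0n.
have nE : n%:R = #|~: errors pis pi|%:R + #|errors pis pi|%:R :> R.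
  by rewrite -natrD addnC cardsC card_ord.
have -> : 1 - #|errors pis pi|%:R / n%:R = #|~: errors pis pi|%:R / n%:R :> R.
  by apply: (mulIf n0'); rewrite mulrBl !divfK// mul1r [X in X - _]nE addrK.
rewrite /ov; congr (_%:R / _); apply: eq_card => i.
rewrite !inE negbK eq_sym; apply/idP/idP; first by rewrite inE.
by move=> h; rewrite inE.
Qed.

Lemma card_errors (k : nat) :
  (#|[set pi : 'S_n | #|errors pis pi| == k]%SET| <= n ^ k)%N.
Proof.
have ff (m j : nat) : (m ^_ j <= m ^ j)%N.
  elim: j m => [|j IH] [|m]//; rewrite ffactSS expnS leq_mul2l/=.
  by apply: leq_trans (IH m) _; case: (posnP j) => [->|j0]; rewrite ?expn0 ?leq_exp2r.
apply: leq_trans (ff _ _); rewrite -bin_ffact.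
rewrite -sum1_card (partition_big (errors pis) (fun A : {set 'I_n} => #|A| == k))/=;
  last by move=> pi; rewrite inE.
apply: (@leq_trans (\sum_(A : {set 'I_n} | #|A| == k) k`!)).
  apply: leq_sum => A /eqP cA; rewrite sum1_card -cA -card_perm.
  rewrite -(card_imset _ (mulIg pis^-1%g)).
  apply: subset_leq_card; apply/fintype.subsetP => _ /imsetP[pi + ->].
  rewrite !unfold_in/= => /andP[_ /eqP <-].
  apply/fintype.subsetP => i; rewrite !inE permM => h; apply: contraNneq h => ->.
  by rewrite permK.
rewrite -[X in 'C(X, k)](card_ord n) -card_draws -sum_nat_const leq_eqVlt.
by apply/orP; left; apply/eqP; apply: eq_bigl => A; rewrite inE.
Qed.

End maximum_likelihood.

(** * Singular values of the Gaussian matrices *)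

Section tail_events.
Context {R : realType}.

Lemma net_size_le (q D : nat) :
  (2 * expR 1 * q.+1%:R) ^+ D <= expR ((2 * q + 2)%:R * D%:R) :> R.
Proof.
rewrite [_%:R * _%:R]mulrC expRM_natl; apply: lerXn2r; rewrite ?nnegrE ?expR_ge0//.
have -> : (2 * q + 2)%:R = 1 + (2 * q + 1)%:R :> R.
  by rewrite nat1r; congr (_%:R); lia.
rewrite expRD mulrAC mulrC ler_pM2l ?expR_gt0//.
apply: le_trans (expR_ge1Dx _); rewrite -natrM nat1r ler_nat; lia.
Qed.

Lemma ln2_le1 : ln 2 <= 1 :> R.
Proof. by have := @le_ln1Dx R 1; rewrite (_ : 1 + 1 = 2)//; apply; lra. Qed.

Section samples.
Context {d n : nat}.
Local Notation K := (bool * 'I_d * 'I_n)%type.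
Local Notation V := (@coordspace R K).
Variable nu : probability V R.
Hypothesis nuG : std_gaussian nu.
Hypotheses (d0 : (0 < d)%N) (dn : (d <= n)%N).

Lemma measurable_energy b (F : {set 'I_n}) (u : 'I_d -> R) :
  measurable_fun setT (fun v : V => energy b v F u).
Proof.
apply: measurable_sum_cond => i; apply: measurable_funX; exact: measurable_proj.
Qed.

(** With [t = - 1 / 4] the moment is [2 ^ (n / 2)], so energy above [32 * n] has probability at most
    [exp (- 7 n)] per net point, against [exp (6 d)] points. The rounding of [op_bound_net] gives
    [128 = 4 * 32]. *)
Lemma op_bound_event b : exists B : set V, [/\ measurable B,
  (nu B <= (expR (- n%:R))%:E)%E & forall v, ~ B v -> op_bound b v (128 * n%:R)].
Proof.
have [m [N [mN N1 Nnet]]] := @sphere_net R d 2 d0 isT.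
pose f (j : 'I_m) (v : V) := - (- 4^-1 * energy b v [set: 'I_n] (N j)) + - (8 * n%:R).
have mfj j : measurable_fun setT
    (fun v : V => - (- 4^-1 * energy b v [set: 'I_n] (N j))).
  apply: measurable_funN; apply: measurable_funM; first exact: measurable_cst.
  exact: measurable_energy.
have mf j : measurable_fun setT (f j).
  by apply: measurable_funD (mfj j) _; exact: measurable_cst.
have [|B [mB leB Bf]] := @union_chernoff _ _ nu _ (enum 'I_m) f (expR (- (7 * n%:R))) mf.
  move=> j _; rewrite /f (mexpDr _ _ (mfj j)).
  rewrite (mexp_sum_sqr_proj nuG) ?N1//; last by lra.
  rewrite -EFinM -expRD lee_fin ler_expR cardsT card_ord.
  have -> : 1 + 2 * (- 4^-1) = 2^-1 :> R by field.
  rewrite lnV ?posrE//; have := ln2_le1.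
  have : 0 <= n%:R :> R by exact: ler0n.
  move: (n%:R) (ln 2) => x y x0 y1.
  have : x * y <= x * 1 by exact: ler_wpM2l.
  lra.
exists B; split=> //.
  apply: (le_trans leB); rewrite lee_fin size_enum_ord.
  apply: (@le_trans _ _ (expR (6 * n%:R) * expR (- (7 * n%:R)))).
    apply: ler_wpM2r; first exact: expR_ge0.
    apply: (le_trans mN); apply: (le_trans (net_size_le _ _)).
    by rewrite ler_expR ler_pM2l ?ltr0n// ler_nat.
  by rewrite -expRD ler_expR; lra.
move=> v nBv; rewrite (_ : 128 * n%:R = 4 * (32 * n%:R)); last by ring.
apply: (op_bound_net (N := N)) => //.
move=> j; have := Bf v nBv j; rewrite mem_enum => /(_ isT); rewrite /f.
by move: (energy _ _ _ _) => x; lra.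
Qed.

(** [1 + 2 * s = exp 16] makes each column contribute [exp (- 8)], hence [exp (- 4 n)] over at least
    [n / 2] columns. A factor [exp n] goes to each of the level [n / s = 4 * c * n], the choice of
    [F] and the net, which leaves [exp (- n)]. *)
Lemma energy_lower_event (s c : R) (q : nat) :
  expR 16 = 1 + 2 * s -> 4 * c * s = 1 -> (0 < q)%N -> 128 <= c * q%:R ^+ 2 ->
  ((2 * q + 2) * d <= n)%N ->
  exists B : set V, [/\ measurable B, (nu B <= (expR (- n%:R))%:E)%E &
    forall v, ~ B v -> op_bound true v (128 * n%:R) ->
    forall (F : {set 'I_n}) u, (n <= 2 * #|F|)%N ->
      c * n%:R * \sum_l u l ^+ 2 <= energy true v F u].
Proof.
move=> sE cs q0 cq dq.
have s0 : 0 < s by have := @expR_gt1Dx R 16; lra.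
have c0 : 0 < c.
  by rewrite -(pmulr_lgt0 _ s0) -(pmulr_rgt0 _ (ltr0n R 4)) mulrA cs.
have [m [N [mN N1 Nnet]]] := @sphere_net R d q d0 q0.
pose I := ({set 'I_n} * 'I_m)%type.
pose f (p : I) (v : V) := - (s * energy true v p.1 (N p.2)) + n%:R.
have mfp (p : I) : measurable_fun setT (fun v : V => - (s * energy true v p.1 (N p.2))).
  apply: measurable_funN; apply: measurable_funM; first exact: measurable_cst.
  exact: measurable_energy.
have mf p : measurable_fun setT (f p).
  by apply: measurable_funD (mfp p) _; exact: measurable_cst.
pose idx := enum [pred p : I | (n <= 2 * #|p.1|)%N].
have [|B [mB leB Bf]] := @union_chernoff _ _ nu _ idx f (expR (- (3 * n%:R))) mf.
  move=> p; rewrite mem_enum inE => np.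
  rewrite /f (mexpDr _ _ (mfp p)) (mexp_sum_sqr_proj nuG) ?N1//; last by lra.
  rewrite -EFinM -expRD lee_fin ler_expR -sE expRK.
  have : n%:R <= 2 * #|p.1|%:R :> R by rewrite -natrM ler_nat.
  lra.
have n0 : 0 <= n%:R :> R by exact: ler0n.
exists B; split=> //.
  apply: (le_trans leB); rewrite lee_fin.
  apply: (@le_trans _ _ (expR n%:R * expR n%:R * expR (- (3 * n%:R)))).
    apply: ler_wpM2r; first exact: expR_ge0.
    apply: (@le_trans _ _ ((2 ^ n * m)%:R)).
      rewrite ler_nat -cardE; apply: (leq_trans (max_card _)).
      by rewrite card_prod card_ord -cardsT -powersetT card_powerset cardsT card_ord.
    rewrite natrM; apply: ler_pM => //.
      rewrite natrX -[n%:R]mulr1 expRM_natl lerXn2r ?nnegrE ?expR_ge0//.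
      by have := @expR_ge1Dx R 1; lra.
    apply: (le_trans mN); apply: (le_trans (net_size_le _ _)).
    by rewrite ler_expR -natrM ler_nat.
  by rewrite -!expRD ler_expR; lra.
move=> v nBv vX F u nF.
apply: (energy_lower_net (N := N) (S := 128) (q := q)) => //.
move=> j; have := Bf v nBv (F, j); rewrite mem_enum inE => /(_ nF); rewrite /f/=.
have sn0 : s != 0 by rewrite gt_eqF.
have -> : 4 * c = s^-1 by apply: (mulIf sn0); rewrite cs mulVf.
rewrite addrC subr_lt0 => /ltW le; rewrite mulrC ler_pdivrMr// [leRHS]mulrC.
exact: le.
Qed.

End samples.
End tail_events.

(** * Positivity of the gap for one permutation and all rotations *)

Section gap_event.
Context {R : realType}.

Lemma expR_12_5_le : expR (12 / 5) <= 16 :> R.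
Proof.
rewrite expRM_natl.
have e5 : expR 5^-1 <= 5 / 4 :> R.
  have := @expR_ge1Dx R (- 5^-1); rewrite expRN => h.
  have e0 : 0 < expR 5^-1 :> R by exact: expR_gt0.
  have : (1 - 5^-1) * expR 5^-1 <= (expR 5^-1)^-1 * expR 5^-1 :> R.
    by rewrite ler_pM2r.
  by rewrite mulVf ?gt_eqF//; lra.
apply: (@le_trans _ _ ((5 / 4) ^+ 12)).
  by apply: lerXn2r; rewrite ?nnegrE ?expR_ge0.
by lra.
Qed.

(** With [w] the square root of [r], [1 + 15 * w ^+ 2 - 16 * w] factors as [(w - 1) * (15 * w - 1)],
    and [expR (12 / 5) <= 16]. *)
Lemma ln_1D15_ge (r : R) : 1 <= r -> 12 / 5 + ln r / 2 <= ln (1 + 15 * r).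
Proof.
move=> r1; have r0 : 0 < r by lra.
rewrite -ler_expR lnK ?posrE; last by lra.
rewrite expRD; set w := expR (ln r / 2).
have w1 : 1 <= w by rewrite -expR0 ler_expR divr_ge0// ln_ge0.
have w2 : w ^+ 2 = r by rewrite -expRM_natl mulrC divfK ?pnatr_eq0// lnK.
have h : expR (12 / 5) * w <= 16 * w.
  by apply: ler_wpM2r; [lra|exact: expR_12_5_le].
apply: (le_trans h); rewrite -w2 -subr_ge0.
have -> : 1 + 15 * w ^+ 2 - 16 * w = (w - 1) * (15 * w - 1) by ring.
by rewrite mulr_ge0//; lra.
Qed.

(* Balances the size of the orthogonal net (mesh [1 / q]), the cost [lam * slack]
   of rounding to the net, the lower tail of the gap and the number [n ^ k] of
   permutations; [r = n / k]. *)
Lemma gap_exponent (k n d C q : nat) (A : R) : (0 < k)%N -> (k <= n)%N -> (0 < d)%N ->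
  2 * ln n%:R <= d%:R :> R -> 200 ^+ 3 <= C%:R :> R ->
  100 * (10 * C%:R + 1) <= A -> A * d%:R <= k%:R ->
  q = (C * (n %/ k).+1 ^ 2)%N ->
  (2 * expR 1 * q.+1%:R) ^+ (d * d) *
  (expR (30 * (n%:R / k%:R) * (6 * (128 * n%:R * d%:R) / q%:R)) *
   expR (- ((k * d)%:R / 4 * ln (1 + 30 * (n%:R / k%:R) / 2))))
  <= expR (- (k%:R * ln n%:R) - 2 * ln n%:R) :> R.
Proof.
move=> k0 kn d0 lnd hC hA hk qC; set r := n%:R / k%:R : R.
have k0' : 0 < k%:R :> R by rewrite ltr0n.
have d1 : 1 <= d%:R :> R by rewrite ler1n.
have n0 : 0 < n%:R :> R by rewrite ltr0n (leq_trans k0).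
have C0 : 0 < C%:R :> R by lra.
have r1 : 1 <= r by rewrite ler_pdivlMr// mul1r ler_nat.
have r0 : 0 < r by lra.
have rk : n%:R = r * k%:R by rewrite divfK// gt_eqF.
pose s : R := (n %/ k).+1%:R.
have rs : r <= s.
  by rewrite ler_pdivrMr// -natrM ler_nat ltnW// ltn_ceil.
have sr : s <= 2 * r.
  have : (n %/ k)%:R <= r by rewrite ler_pdivlMr// -natrM ler_nat leq_divM.
  by rewrite /s -natr1; lra.
have qE : q%:R = C%:R * s ^+ 2 by rewrite qC natrM natrX.
have r2s2 : r ^+ 2 <= s ^+ 2 by apply: lerXn2r; rewrite ?nnegrE//; lra.
have s2r2 : s ^+ 2 <= 4 * r ^+ 2.
  rewrite (_ : 4 * r ^+ 2 = (2 * r) ^+ 2); last by ring.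
  by apply: lerXn2r; rewrite ?nnegrE//; lra.
have r2 : 1 <= r ^+ 2 by rewrite expr_ge1//; lra.
pose L := ln r; have L0 : 0 <= L by rewrite ln_ge0.
have h1 : 2 * expR 1 * q.+1%:R <= expR (10 * C%:R + 1 + 2 * L).
  have -> : expR (10 * C%:R + 1 + 2 * L) = expR (10 * C%:R) * expR 1 * r ^+ 2.
    by rewrite !expRD (expRM_natl 2 L) lnK ?posrE.
  rewrite mulrAC [leRHS]mulrAC ler_pM2r ?expR_gt0//.
  apply: (@le_trans _ _ (10 * C%:R * r ^+ 2)).
    have -> : q.+1%:R = C%:R * s ^+ 2 + 1 :> R by rewrite -qE natr1.
    have a1 : C%:R * s ^+ 2 <= C%:R * (4 * r ^+ 2) by rewrite ler_pM2l.
    have a2 : C%:R * 1 <= C%:R * r ^+ 2 by rewrite ler_pM2l.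
    by move: (C%:R * s ^+ 2) a1 => x a1; lra.
  rewrite ler_pM2r; last by lra.
  by have := @expR_ge1Dx R (10 * C%:R); lra.
have h2 : (2 * expR 1 * q.+1%:R) ^+ (d * d) <=
    expR ((d * d)%:R * (10 * C%:R + 1 + 2 * L)).
  rewrite expRM_natl; apply: lerXn2r; rewrite ?nnegrE ?expR_ge0//.
have q0 : 0 < q%:R :> R by rewrite qE mulr_gt0//; lra.
have kd0 : 0 <= k%:R * d%:R :> R by rewrite mulr_ge0.
(* The size of [C] is spent here: [100 * 30 * 6 * 128 <= 200 ^ 3]. *)
have h3 : 30 * r * (6 * (128 * n%:R * d%:R) / q%:R) <= k%:R * d%:R / 100.
  rewrite [30 * r * _]mulrA ler_pdivrMr// qE rk.
  have a1 : C%:R * (r ^+ 2 * (k%:R * d%:R)) <= C%:R * (s ^+ 2 * (k%:R * d%:R)).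
    by apply: ler_wpM2l; [lra|apply: ler_wpM2r].
  have a2 : 200 ^+ 3 * (r ^+ 2 * (k%:R * d%:R)) <= C%:R * (r ^+ 2 * (k%:R * d%:R)).
    by apply: ler_wpM2r => //; rewrite mulr_ge0//; lra.
  have a3 : 0 <= r ^+ 2 * (k%:R * d%:R) by rewrite mulr_ge0//; lra.
  have -> : 30 * r * (6 * (128 * (r * k%:R) * d%:R)) = 30 * 6 * 128 * (r ^+ 2 * (k%:R * d%:R)) by ring.
  have -> : k%:R * d%:R / 100 * (C%:R * s ^+ 2) = C%:R * (s ^+ 2 * (k%:R * d%:R)) / 100 by field.
  by move: (r ^+ 2 * _) (C%:R * (r ^+ 2 * _)) (C%:R * (s ^+ 2 * _)) a1 a2 a3 => x y z; lra.
have h4 : 12 / 5 + L / 2 <= ln (1 + 30 * r / 2).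
  by rewrite (_ : 30 * r / 2 = 15 * r); [exact: ln_1D15_ge|field].
apply: (@le_trans _ _ (expR ((d * d)%:R * (10 * C%:R + 1 + 2 * L)) *
    (expR (k%:R * d%:R / 100) * expR (- (k%:R * d%:R / 4 * (12 / 5 + L / 2)))))).
  apply: ler_pM h2 _ => //.
  apply: ler_pM; rewrite ?expR_ge0 ?ler_expR// lerN2 natrM.
  by apply: ler_wpM2l => //; rewrite divr_ge0.
(* Budget in units of [k * d]: the constant part of the net entropy, the rounding and the spare
   [2 * ln n] cost at most [1 / 100] each, the permutations [1 / 2], against a gain of [3 / 5].
   Separately, the net costs [2 * L / 100] against a gain of [L / 8]. *)
rewrite -!expRD ler_expR natrM.
have dd0 : 0 <= d%:R * d%:R :> R by rewrite mulr_ge0.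
have b1 : d%:R * (A * d%:R) <= d%:R * k%:R :> R by apply: ler_wpM2l.
have b2 : d%:R * d%:R * (100 * (10 * C%:R + 1)) <= d%:R * d%:R * A.
  exact: ler_wpM2l.
have b3 : k%:R * (2 * ln n%:R) <= k%:R * d%:R :> R by apply: ler_wpM2l.
have b4 : d%:R * 1 <= d%:R * d%:R :> R by apply: ler_wpM2l.
have kdA : d%:R * d%:R * A <= k%:R * d%:R by rewrite -mulrA [X in _ * X]mulrC [leRHS]mulrC.
have b5 : d%:R * d%:R * 100 <= d%:R * d%:R * A.
  by apply: ler_wpM2l => //; lra.
have b6 : L * (d%:R * d%:R * 100) <= L * (k%:R * d%:R).
  by apply: ler_wpM2l => //; lra.
have LE : d%:R * d%:R * (10 * C%:R + 1 + 2 * L) =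
    d%:R * d%:R * (100 * (10 * C%:R + 1)) / 100 + 2 * (L * (d%:R * d%:R * 100)) / 100 by field.
have LE2 : k%:R * d%:R / 4 * (12 / 5 + L / 2) = 3 / 5 * (k%:R * d%:R) + (L * (k%:R * d%:R)) / 8.
  by field.
have kE : k%:R * ln n%:R = k%:R * (2 * ln n%:R) / 2 :> R by field.
have Lkd0 : 0 <= L * (k%:R * d%:R) by rewrite mulr_ge0.
rewrite LE LE2 kE.
move: (d%:R * d%:R * (100 * (10 * C%:R + 1))) (L * (d%:R * d%:R * 100))
  (L * (k%:R * d%:R)) (k%:R * (2 * ln n%:R)) (d%:R * d%:R * A)
  b2 b3 b6 kdA b5 Lkd0 => x1 x2 x3 x4 x5 b2 b3 b6 kdA b5 Lkd0.
by move: (k%:R * d%:R) (d%:R * d%:R) kdA b3 b4 b5 b6 => y z; lra.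
Qed.

Section samples.
Context {d n : nat}.
Local Notation K := (bool * 'I_d * 'I_n)%type.
Local Notation V := (@coordspace R K).
Variable nu : probability V R.
Hypothesis nuG : std_gaussian nu.
Variables (Qs : 'M[R]_d) (pis : 'S_n) (sigma : R).
Hypotheses (d0 : (0 < d)%N) (oQs : orthogonal_mx Qs) (sigma0 : 0 <= sigma).
Hypothesis lnd : 2 * ln n%:R <= d%:R :> R.

Lemma gap_event (pi : 'S_n) (C : nat) (A : R) : let k := #|errors pis pi| in
  200 ^+ 3 <= C%:R :> R -> 100 * (10 * C%:R + 1) <= A ->
  A * d%:R <= k%:R -> 60 * sigma ^+ 2 * n%:R <= k%:R ->
  exists B : set V, [/\ measurable B,
    (nu B <= (expR (- (k%:R * ln n%:R) - 2 * ln n%:R))%:E)%E &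
    forall v, ~ B v -> op_bound true v (128 * n%:R) -> op_bound false v (128 * n%:R) ->
    forall Q, orthogonal_mx Q -> 0 < gap Qs pis sigma Q pi v].
Proof.
move=> k hC hA hk hs.
have C0 : 0 < C%:R :> R by lra.
have d0' : 0 < d%:R :> R by rewrite ltr0n.
have k0' : 0 < k%:R :> R by apply: lt_le_trans hk; rewrite mulr_gt0//; lra.
have k0 : (0 < k)%N by rewrite -(ltr0n R).
have kn : (k <= n)%N by rewrite -[leqRHS]card_ord max_card.
have n0 : 0 < n%:R :> R by rewrite ltr0n (leq_trans k0).
pose q := (C * (n %/ k).+1 ^ 2)%N.
have q0 : (0 < q)%N by rewrite muln_gt0 expn_gt0 /= andbT -(ltr0n R).
have [m [N [mN oN Nnet]]] := @orthogonal_net R d q d0 q0.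
pose lam : R := 30 * (n%:R / k%:R).
have lam0 : 0 < lam by rewrite mulr_gt0// divr_gt0.
(* The origin of 60: with [lam = 30 * n / k] this is exactly [60 * sigma ^+ 2 * n <= k]. *)
have lams : lam * sigma ^+ 2 <= 2^-1.
  rewrite /lam -mulrA mulrAC mulrA ler_pdivrMr//.
  by rewrite (_ : 30 * (n%:R * sigma ^+ 2) = 60 * sigma ^+ 2 * n%:R / 2); [lra|field].
have sigma1 : sigma <= 1.
  rewrite -(@ler_pXn2r _ 2) ?nnegrE// expr1n.
  have : 60 * sigma ^+ 2 * n%:R <= 1 * n%:R.
    by rewrite mul1r (le_trans hs)// ler_nat.
  by rewrite ler_pM2r//; have := sqr_ge0 sigma; lra.
pose slack : R := 6 * (128 * n%:R * d%:R) / q%:R.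
have mg j : measurable_fun setT (fun v : V => - (lam * gap Qs pis sigma (N j) pi v)).
  apply: measurable_funN; apply: measurable_funM; first exact: measurable_cst.
  exact: measurable_gap.
pose f (j : 'I_m) (v : V) := - (lam * gap Qs pis sigma (N j) pi v) + lam * slack.
have mf j : measurable_fun setT (f j).
  by apply: measurable_funD (mg j) _; exact: measurable_cst.
have [|B [mB leB Bf]] := @union_chernoff _ _ nu _ (enum 'I_m) f
  (expR (lam * slack) * expR (- ((k * d)%:R / 4 * ln (1 + lam / 2)))) mf.
  move=> j _; rewrite /f (mexpDr _ _ (mg j)) muleC EFinM.
  apply: lee_wpmul2l; first by rewrite lee_fin expR_ge0.
  by apply: mexp_gap => //; exact: ltW.
exists B; split=> //.
  apply: (le_trans leB); rewrite lee_fin size_enum_ord.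
  apply: le_trans (gap_exponent k0 kn d0 lnd hC hA hk (erefl q)).
  by apply: ler_wpM2r mN; rewrite mulr_ge0// expR_ge0.
move=> v nBv vX vZ Q oQ; have [j QN] := Nnet Q oQ.
have := Bf v nBv j; rewrite mem_enum => /(_ isT); rewrite /f.
rewrite addrC subr_lt0 ltr_pM2l// => lt.
have C0n : 0 <= 128 * n%:R :> R by rewrite mulr_ge0.
have s01 : 0 <= sigma <= 1 by rewrite sigma0.
have h : gap Qs pis sigma (N j) pi v - slack <= gap Qs pis sigma Q pi v.
  exact: gap_perturbation.
by apply: lt_le_trans h; rewrite subr_gt0.
Qed.

End samples.
End gap_event.

(** * Union over permutations and the good event *)

Section good_event.
Context {R : realType} {d n : nat}.
Local Notation K := (bool * 'I_d * 'I_n)%type.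
Local Notation V := (@coordspace R K).
Variable nu : probability V R.
Hypothesis nuG : std_gaussian nu.
Variables (Qs : 'M[R]_d) (pis : 'S_n) (sigma : R).
Hypotheses (n0 : (0 < n)%N) (d0 : (0 < d)%N) (oQs : orthogonal_mx Qs).
Hypotheses (sigma0 : 0 <= sigma) (lnd : 2 * ln n%:R <= d%:R :> R).

(** The at most [n ^ k] permutations with [k] errors fail with probability at most [n ^ (- k - 2)]
    each. This leaves [n ^ (- 2)] per value of [k], and [(n + 1) / n ^ 2 <= 2 / n] in all. *)
Lemma permutations_event (C : nat) (A : R) :
  200 ^+ 3 <= C%:R :> R -> 100 * (10 * C%:R + 1) <= A ->
  exists B : set V, [/\ measurable B, (nu B <= (2 / n%:R)%:E)%E &
    forall v, ~ B v -> op_bound true v (128 * n%:R) -> op_bound false v (128 * n%:R) ->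
    forall pi Q, orthogonal_mx Q -> A * d%:R <= #|errors pis pi|%:R ->
      60 * sigma ^+ 2 * n%:R <= #|errors pis pi|%:R -> 0 < gap Qs pis sigma Q pi v].
Proof.
move=> hC hA.
pose k (pi : 'S_n) := #|errors pis pi|.
pose r (pi : 'S_n) : R := expR (- ((k pi)%:R * ln n%:R) - 2 * ln n%:R).
pose big (pi : 'S_n) := (A * d%:R <= (k pi)%:R) && (60 * sigma ^+ 2 * n%:R <= (k pi)%:R).
have n0' : 0 < n%:R :> R by rewrite ltr0n.
pose bad_set (pi : 'S_n) (B : set V) := big pi -> [/\ measurable B,
    (nu B <= (r pi)%:E)%E & forall v, ~ B v ->
    op_bound true v (128 * n%:R) -> op_bound false v (128 * n%:R) ->
    forall Q, orthogonal_mx Q -> 0 < gap Qs pis sigma Q pi v].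
have exB pi : exists B, bad_set pi B.
  rewrite /bad_set; case: (boolP (big pi)) => [/andP[h1 h2]|_].
    have [B BP] := gap_event nuG d0 oQs sigma0 lnd hC hA h1 h2.
    by exists B.
  (* Default value: [bad_set] is vacuous when [pi] has too few errors. *)
  by exists classical_sets.set0.
have [B BP] := choice exB.
have bigE pi : pi \in enum big -> big pi by rewrite mem_enum.
have [||mB leB] := @boole_seq _ _ nu _ (enum big) B r.
- by move=> pi /bigE/BP[].
- by move=> pi /bigE/BP[].
eexists; split; [exact: mB| |].
  apply: (le_trans leB); rewrite lee_fin big_enum.
  apply: (@le_trans _ _ (\sum_pi r pi)).
    rewrite [leRHS](bigID (mem big))/= lerDl.
    by apply: sumr_ge0 => pi _; exact: expR_ge0.
  have kn pi : (k pi < n.+1)%N by rewrite ltnS -[leqRHS]card_ord max_card.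
  have rE pi : r pi = n%:R ^- k pi * n%:R ^- 2.
    by rewrite /r expRD !expRN !expRM_natl lnK.
  rewrite (partition_big (fun pi => inord (k pi) : 'I_n.+1) predT)//=.
  apply: (@le_trans _ _ (\sum_(j < n.+1) n%:R ^- 2)).
    apply: ler_sum => j _.
    apply: (@le_trans _ _ (\sum_(pi in [set pi : 'S_n | k pi == j]%SET)
        (n%:R ^- j * n%:R ^- 2))).
      rewrite le_eqVlt; apply/orP; left; apply/eqP.
      apply: eq_big => pi.
        by rewrite inE -(inj_eq val_inj) /= inordK.
      by rewrite -(inj_eq val_inj) /= inordK// rE => /eqP ->.
    rewrite sumr_const -[leLHS]mulr_natl mulrA ler_piMl ?invr_ge0 ?exprn_ge0//.
    rewrite ler_pdivrMr ?exprn_gt0// mul1r -natrX ler_nat.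
    exact: card_errors.
  rewrite sumr_const card_ord -[leLHS]mulr_natl.
  rewrite ler_pdivrMr ?exprn_gt0// (_ : 2 / n%:R * n%:R ^+ 2 = 2 * n%:R); last first.
    by field; rewrite gt_eqF.
  by rewrite -natrM ler_nat; lia.
move=> v nBv vX vZ pi Q oQ h1 h2.
have pib : big pi by rewrite /big h1 h2.
have [_ _] := BP pi pib; apply=> // Bv; apply: nBv; exists pi => //.
by rewrite mem_enum.
Qed.

(** Too many errors would make the gap positive, against [mle_gap]. The loss [5 / n] is three times
    [exp (- n) <= 1 / n] plus [2 / n], and [512 = 4 * 128]. *)
Lemma good_event (C q : nat) (A s c : R) :
  200 ^+ 3 <= C%:R :> R -> 100 * (10 * C%:R + 1) <= A ->
  expR 16 = 1 + 2 * s -> 4 * c * s = 1 -> (0 < q)%N -> 128 <= c * q%:R ^+ 2 ->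
  ((2 * q + 2) * d <= n)%N ->
  exists E : set V, [/\ measurable E, ((1 - 5 / n%:R)%:E <= nu E)%E &
    forall v, E v -> forall pi Q,
      let X := \matrix_(k < d, i < n) v (true, k, i) in
      let Z := \matrix_(k < d, i < n) v (false, k, i) in
      is_mle X (obs_matrix Qs pis sigma X Z) pi Q ->
      #|errors pis pi|%:R <= Num.max (60 * sigma ^+ 2 * n%:R) (A * d%:R) /\
      ((2 * #|errors pis pi| <= n)%N ->
       c * ell2 Qs Q <= 512 * sigma ^+ 2 * d%:R)].
Proof.
move=> hC hA sE cs q0 cq dq.
have n0' : 0 < n%:R :> R by rewrite ltr0n.
have dn : (d <= n)%N by apply: leq_trans dq; rewrite leq_pmull// addn2.
have [B1 [mB1 le1 P1]] := op_bound_event nuG d0 dn true.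
have [B2 [mB2 le2 P2]] := op_bound_event nuG d0 dn false.
have [B3 [mB3 le3 P3]] := energy_lower_event nuG d0 sE cs q0 cq dq.
have [B4 [mB4 le4 P4]] := permutations_event hC hA.
have mB12 : measurable (B1 `|` B2) by exact: measurableU.
have mB34 : measurable (B3 `|` B4) by exact: measurableU.
have mB : measurable (B1 `|` B2 `|` (B3 `|` B4)) by exact: measurableU.
exists (~` (B1 `|` B2 `|` (B3 `|` B4))); split.
- exact: measurableC.
- have -> : nu (~` (B1 `|` B2 `|` (B3 `|` B4))) = (1 - nu (B1 `|` B2 `|` (B3 `|` B4)))%E.
    exact: probability_setC.
  rewrite EFinB; apply: leeB => //.
  have en : expR (- n%:R) <= n%:R^-1 :> R.
    by rewrite expRN lef_pV2 ?posrE ?expR_gt0//; have := @expR_ge1Dx R n%:R; lra.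
  have lee (x : \bar R) : (x <= (expR (- n%:R))%:E -> x <= (n%:R^-1)%:E)%E.
    by move/le_trans; apply; rewrite lee_fin.
  apply: (le_trans (measureU2 _ mB12 mB34)).
  have -> : (5 / n%:R)%:E = ((n%:R^-1)%:E + (n%:R^-1)%:E + ((n%:R^-1)%:E + (2 / n%:R)%:E))%E :> \bar R.
    by rewrite -!EFinD; congr EFin; field; rewrite gt_eqF.
  apply: leeD.
    by apply: (le_trans (measureU2 _ mB1 mB2)); apply: leeD; apply: lee.
  by apply: (le_trans (measureU2 _ mB3 mB4)); apply: leeD => //; apply: lee.
move=> v nB pi Q X Z mle.
have vX : op_bound true v (128 * n%:R) by apply: P1 => h; apply: nB; do 2 left.
have vZ : op_bound false v (128 * n%:R) by apply: P2 => h; apply: nB; left; right.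
have low := P3 v (fun h => nB (or_intror (or_introl h))) vX.
have pos := P4 v (fun h => nB (or_intror (or_intror h))) vX vZ.
have oQ : orthogonal_mx Q by case: mle.
have g0 : gap Qs pis sigma Q pi v <= 0 by exact: mle_gap oQs n0 mle.
split.
  rewrite leNgt gt_max; apply/negP => /andP[h1 h2].
  by have := pos pi Q oQ (ltW h2) (ltW h1); rewrite ltNge g0.
move=> err; have := gap_ell2 oQs oQ g0 vZ low err.
rewrite mulrAC (_ : 4 * sigma ^+ 2 * (128 * n%:R * d%:R) = 512 * sigma ^+ 2 * d%:R * n%:R);
  last by ring.
by rewrite ler_pM2r.
Qed.

End good_event.

(** * Transfer to the given probability space *)

Section gaussian_law.
Context {R : realType} {dT : measure_display} {T : measurableType dT}.
Variables (P : probability T R) (d n : nat) (X Z : 'I_d -> 'I_n -> T -> R).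
Local Notation K := (bool * 'I_d * 'I_n)%type.

Definition joint_sample (w : T) : @coordspace R K :=
  fun k => if k.1.1 then X k.1.2 k.2 w else Z k.1.2 k.2 w.

(** The independence clause of [gaussian_design] evaluates the joint law on rectangles over all
    coordinates at once, which is the product formula of [std_gaussian]; events are then pulled back
    along [joint_sample]. *)
Lemma gaussian_design_law : gaussian_design P X Z ->
  measurable_fun setT joint_sample /\
  exists nu : probability (@coordspace R K) R,
    std_gaussian nu /\ forall A, nu A = P (joint_sample @^-1` A).
Proof.
case; set W := (W in forall k, measurable_fun setT (W k)) => mW [lawW indW].
have rectE B : joint_sample @^-1` rectangle B =
    \bigcap_(k in [set: K]) (W k @^-1` B k).
  apply/seteqP; split=> w /= h k; first by move=> _; have := h k; rewrite /joint_sample /W; case: ifP.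
  by have := h k I; rewrite /joint_sample /W /=; case: ifP.
have mJ : measurable_fun setT joint_sample.
  apply: measurable_fun_coordspace => B mB; rewrite rectE.
  apply: fin_bigcap_measurable; first exact: finite_finset.
  by move=> k _; rewrite -[_ @^-1` _]setTI; exact: (mW k).
split=> //.
pose J : {mfun T >-> @coordspace R K} :=
  HB.pack joint_sample (isMeasurableFun.Build _ _ _ _ joint_sample mJ).
exists (distribution P J); split=> // B mB.
transitivity (P (joint_sample @^-1` rectangle B)) => //.
rewrite rectE; apply: (eq_trans (indW B mB)).
rewrite (big_morph EFin EFinM (erefl _)); apply: eq_bigr => k _.
rewrite fineK ?lawW//; apply: fin_num_measure; exact: mB.
Qed.

End gaussian_law.

(** * Universal constants and the theorem *)

Lemma ell2_orthogonal_le (R : realType) (d : nat) (Q Q' : 'M[R]_d) :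
  orthogonal_mx Q -> orthogonal_mx Q' -> ell2 Q Q' <= 4 * d%:R.
Proof.
move=> oQ oQ'.
rewrite (_ : 4 * d%:R = 2 * d%:R + 2 * d%:R :> R); last by ring.
rewrite -{1}(sum_sqr_orthogonal_mx oQ) -(sum_sqr_orthogonal_mx oQ').
rewrite !mulr_sumr -big_split; apply: ler_sum => i _ /=.
rewrite !mulr_sumr -big_split; apply: ler_sum => j _ /=.
by have := sqr_ge0 (Q i j + Q' i j); rewrite sqrrD sqrrB; lra.
Qed.

Lemma cvg_1B5V (R : realType) : (fun n => (1 - 5 / n%:R)%:E : \bar R) @ \oo --> 1%E.
Proof.
have c0 : (n%:R^-1 : R) @[n --> \oo] --> (0 : R).
  apply/gtr0_cvgV0; last exact: cvgr_idn.
  by near=> n; rewrite ltr0n; near: n; exact: nbhs_infty_gt.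
apply: cvg_EFin; first by near=> n.
rewrite -[X in _ --> X](_ : 1 - 5 * 0 = 1 :> R); last by rewrite mulr0 subr0.
apply: cvgB; first exact: cvg_cst.
by apply: cvgM; [exact: cvg_cst|exact: c0].
Unshelve. all: end_near. Qed.

Lemma good_event_constants (R : realType) : exists A c : R, [/\ 0 < A, 0 < c &
  forall (d n : nat) (nu : probability (@coordspace R (bool * 'I_d * 'I_n)%type) R)
    (Qs : 'M[R]_d) (pis : 'S_n) (sigma : R),
  std_gaussian nu -> (0 < n)%N -> (0 < d)%N -> orthogonal_mx Qs -> 0 <= sigma ->
  2 * ln n%:R <= d%:R :> R -> A * d%:R <= n%:R ->
  exists E : set (coordspace), [/\ measurable E, ((1 - 5 / n%:R)%:E <= nu E)%E &
    forall v, E v -> forall pi Q,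
      let X := \matrix_(k < d, i < n) v (true, k, i) in
      let Z := \matrix_(k < d, i < n) v (false, k, i) in
      is_mle X (obs_matrix Qs pis sigma X Z) pi Q ->
      #|errors pis pi|%:R <= Num.max (60 * sigma ^+ 2 * n%:R) (A * d%:R) /\
      ((2 * #|errors pis pi| <= n)%N ->
       c * ell2 Qs Q <= 512 * sigma ^+ 2 * d%:R)]].
Proof.
have [s sE] : exists s, expR 16 = 1 + 2 * s :> R.
  by exists ((expR 16 - 1) / 2); field.
have s0 : 0 < s by have := @expR_gt1Dx R 16; lra.
pose c : R := (4 * s)^-1.
have c0 : 0 < c by rewrite invr_gt0 mulr_gt0.
have cs : 4 * c * s = 1 by rewrite mulrAC mulfV// gt_eqF// mulr_gt0.
pose C := (Num.truncn (200 ^+ 3 : R)).+1.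
have hC : 200 ^+ 3 <= C%:R :> R by apply: ltW; exact: truncnS_gt.
pose q := (Num.truncn (128 / c)).+1.
have cq : 128 <= c * q%:R ^+ 2.
  have h : 128 <= c * q%:R by rewrite mulrC -ler_pdivrMr//; apply: ltW; exact: truncnS_gt.
  by apply: (le_trans h); rewrite ler_pM2l// expr2 ler_peMr// ler1n.
(* The first summand serves the entropy budget of the gap; the second turns [A * d <= n] into the
   room [(2 * q + 2) * d <= n] for the singular value net. *)
pose A : R := 100 * (10 * C%:R + 1) + (2 * q + 2)%:R.
have hA : 100 * (10 * C%:R + 1) <= A by rewrite lerDl.
have qA : (2 * q + 2)%:R <= A by rewrite lerDr !(mulr_ge0, addr_ge0) ?ler0n.
have A0 : 0 < A by apply: lt_le_trans hA; lra.
exists A, c; split=> // d n nu Qs pis sigma nuG n0 d0 oQs sig0 lnd Ad.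
have qd : ((2 * q + 2) * d <= n)%N.
  by rewrite -(ler_nat R) natrM; apply: le_trans Ad; apply: ler_wpM2r.
exact: (@good_event R d n nu nuG Qs pis sigma n0 d0 oQs sig0 lnd C q A s c
  hC hA sE cs isT cq qd).
Qed.

Theorem theorem1 (R : realType) :
  exists c1 c2 c3 : R, 0 < c1 /\ 0 < c2 /\ 0 < c3 /\
  forall (dT : measure_display) (T : measurableType dT) (P : probability T R)
    (d : nat -> nat) (sigma : nat -> R)
    (Qs : forall n : nat, 'M[R]_(d n)) (pis : forall n : nat, 'S_n)
    (X Z : forall n : nat, 'I_(d n) -> 'I_n -> T -> R),
    (forall n, (1 <= d n)%N) ->
    (forall n, 2 * ln (n%:R : R) <= (d n)%:R) ->
    (forall n, 0 < sigma n) ->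
    (forall n, orthogonal_mx (Qs n)) ->
    (forall n, gaussian_design P (X n) (Z n)) ->
    exists E : nat -> set T,
      (forall n, measurable (E n)) /\
      (forall n w, E n w ->
         let Xm := sample_mx (X n) w in
         let Ym := obs_matrix (Qs n) (pis n) (sigma n) Xm (sample_mx (Z n) w) in
         forall (pih : 'S_n) (Qh : 'M[R]_(d n)), is_mle Xm Ym pih Qh ->
           ov R (pis n) pih >=
             1 - Num.max (60 * sigma n ^+ 2)
                   (Num.max (c1 * (d n)%:R / n%:R)
                      (c2 * ln (n%:R : R) / ((d n)%:R * ln ((d n)%:R : R))))
           /\
           ell2 (Qs n) Qh / (2 * (d n)%:R) <=
             c1 * (d n)%:R / n%:R + c2 * sigma n ^+ 2
             + c3 * Num.max ((d n)%:R * ln (n%:R : R) / n%:R)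
                            (Num.sqrt (ln (n%:R : R) / n%:R))) /\
      (fun n => P (E n)) @ \oo --> 1%E.
Proof.
have [A [c [A0 c0 good]]] := good_event_constants R.
(* [4 * A] makes the bounds trivial when [n <= 2 * A * d], 240 makes the second one trivial when
   [60 * sigma ^ 2 >= 1 / 2], and [256 / c] is the estimate [512 / c] divided by the 2 of
   [2 * d]. *)
exists (4 * A), (240 + 256 / c), 1; split; first by rewrite mulr_gt0.
split; first by rewrite addr_gt0 ?divr_gt0 ?ltr0n.
split; first exact: ltr01.
move=> dT T P d sigma Qs pis X Z d1 lnd sig0 oQs gXZ.
pose concl n w :=
  let Xm := sample_mx (X n) w in
  let Ym := obs_matrix (Qs n) (pis n) (sigma n) Xm (sample_mx (Z n) w) in
  forall (pih : 'S_n) (Qh : 'M[R]_(d n)), is_mle Xm Ym pih Qh ->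
   ov R (pis n) pih >=
     1 - Num.max (60 * sigma n ^+ 2)
           (Num.max (4 * A * (d n)%:R / n%:R)
              ((240 + 256 / c) * ln (n%:R : R) / ((d n)%:R * ln ((d n)%:R : R))))
   /\
   ell2 (Qs n) Qh / (2 * (d n)%:R) <=
     4 * A * (d n)%:R / n%:R + (240 + 256 / c) * sigma n ^+ 2
     + 1 * Num.max ((d n)%:R * ln (n%:R : R) / n%:R)
                    (Num.sqrt (ln (n%:R : R) / n%:R)).
suff exE n : exists E, [/\ measurable E,
    ((0 < n)%N -> (1 - 5 / n%:R)%:E <= P E)%E & forall w, E w -> concl n w].
  have [E EP] := choice exE; exists E; split=> [n|]; first by have [] := EP n.
  split=> [n w Ew|]; first by have [_ _] := EP n; apply.
  apply: (squeeze_cvge (f := fun n => (1 - 5 / n%:R)%:E) (h := fun=> 1%E));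
    [|exact: cvg_1B5V|exact: cvg_cst].
  near=> n.
  have [mE le _] := EP n; rewrite probability_le1// andbT; apply: le.
  by near: n; exact: nbhs_infty_gt.
have [n0|n0] := posnP n.
  (* For [n = 0] the empty event is harmless, since only the limit matters. *)
  by exists classical_sets.set0; rewrite n0.
have n0' : 0 < n%:R :> R by rewrite ltr0n.
have d0' : 0 < (d n)%:R :> R by rewrite ltr0n d1.
have M0 : 0 <= 1 * Num.max ((d n)%:R * ln (n%:R : R) / n%:R)
    (Num.sqrt (ln (n%:R : R) / n%:R)).
  by rewrite mul1r le_max sqrtr_ge0 orbT.
have sg0 := sqr_ge0 (sigma n).
have c2s : 240 * sigma n ^+ 2 <= (240 + 256 / c) * sigma n ^+ 2.
  by apply: (ler_wpM2r sg0); rewrite lerDl divr_ge0 ?ler0n// ltW.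
have csg : 0 <= (240 + 256 / c) * sigma n ^+ 2.
  by apply: le_trans c2s; rewrite mulr_ge0 ?ler0n.
have Ad0 : 0 <= 4 * A * (d n)%:R / n%:R.
  by rewrite divr_ge0 ?(ltW n0')// mulr_ge0 ?(ltW d0')// mulr_ge0// ltW.
have ellle Q : orthogonal_mx Q -> ell2 (Qs n) Q / (2 * (d n)%:R) <= 2.
  move=> oQ; rewrite ler_pdivrMr ?mulr_gt0//.
  by have := ell2_orthogonal_le (oQs n) oQ; lra.
(* If [n <= 2 * A * d], then [4 * A * d / n >= 2]: both bounds hold surely, because [ov >= 0] and
   [ell2 / (2 * d) <= 2]. *)
have [dbig|dsmall] := leP n%:R (2 * A * (d n)%:R).
  have big : 2 <= 4 * A * (d n)%:R / n%:R.
    by rewrite ler_pdivlMr//; move: dbig; rewrite -!mulrA; move: (A * _) => y; lra.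
  exists setT; split=> //.
    by move=> _; rewrite probability_setT lee_fin gerBl divr_ge0// ltW.
  move=> w _ Xm Ym pi Q [oQ _]; split; last by have := ellle Q oQ; lra.
  apply: (@le_trans _ _ 0); last by rewrite /ov divr_ge0// ltW.
  rewrite subr_le0 !le_max; apply/orP; right; apply/orP; left; lra.
have Adn : A * (d n)%:R <= n%:R.
  have := mulr_gt0 A0 d0'; move: dsmall; rewrite -mulrA; move: (A * _) => y; lra.
have [mJ [nu [nuG nuE]]] := gaussian_design_law (gXZ n).
have [E [mE leE EP]] := good (d n) n nu (Qs n) (pis n) (sigma n) nuG n0 (d1 n)
  (oQs n) (ltW (sig0 n)) (lnd n) Adn.
exists (joint_sample (X n) (Z n) @^-1` E); split.
- by rewrite -[_ @^-1` _]setTI; exact: mJ.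
- by move=> _; rewrite -nuE.
move=> w Ew Xm Ym pi Q mle.
have [errle ellE] := EP _ Ew pi Q mle.
have oQ : orthogonal_mx Q by case: mle.
split.
  rewrite ov_errors// lerD2l lerN2 ler_pdivrMr//.
  move: errle; rewrite le_max => /orP[h|h]; apply: (le_trans h).
    by apply: ler_wpM2r; [exact: ltW|rewrite le_max lexx].
  apply: (@le_trans _ _ (4 * A * (d n)%:R / n%:R * n%:R)).
    rewrite divfK ?gt_eqF//; apply: ler_wpM2r; first exact: ltW.
    by lra.
  by apply: ler_wpM2r; [exact: ltW|rewrite !le_max lexx orbT].
(* Large noise gives [240 * sigma ^ 2 >= 2], which already dominates. Otherwise both entries of the
   maximum in [errle] are at most [n / 2], as the singular value argument needs. *)
have [sbig|ssmall] := leP (2^-1) (60 * sigma n ^+ 2).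
  by have := ellle Q oQ; lra.
have err : (2 * #|errors (pis n) pi| <= n)%N.
  rewrite -(ler_nat R) natrM; move: errle; rewrite le_max => /orP[h|h]; last first.
    by move: h dsmall; rewrite -!mulrA; move: (A * _) => y; lra.
  have : 60 * sigma n ^+ 2 * n%:R <= 2^-1 * n%:R by rewrite ler_pM2r// ltW.
  lra.
apply: (@le_trans _ _ (256 / c * sigma n ^+ 2)).
  rewrite ler_pdivrMr ?mulr_gt0// -(ler_pM2l c0); apply: (le_trans (ellE err)).
  rewrite le_eqVlt; apply/orP; left; apply/eqP.
  by field; rewrite gt_eqF.
have : (240 + 256 / c) * sigma n ^+ 2 = 240 * sigma n ^+ 2 + 256 / c * sigma n ^+ 2.
  exact: mulrDl.
have : 0 <= 240 * sigma n ^+ 2 by rewrite mulr_ge0 ?ler0n.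
move: (240 * _) (256 / c * _) ((240 + _) * _) => *; lra.
Unshelve. all: end_near. Qed.
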